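(* Let $d\ge 2$, $n\ge 1$, $0<\lambda_-<\lambda_+<\infty$ and $\mathcal K=\{\Sigma\in\mathcal S^{++}(d):\lambda_- I\preceq\Sigma\preceq\lambda_+ I\}$. For every sample $(X_1,\dots,X_n)\in(\mathbb H^d)^n$, the shell-constrained joint log-likelihood $(\mu,\Sigma)\mapsto\ell_n(\mu,\Sigma)$ admits at least one maximizer on $\Theta=\mathbb H^d\times\mathcal K$. Consequently, a shell-constrained profile MLE exists, i.e. there exists a (measurable) maximizer $\hat\mu_n\in\operatorname{argmax}_{\mu\in\mathbb H^d}\ell_n(\mu,\widetilde\Sigma_n(\mu))$, with $\hat\Sigma_n:=\widetilde\Sigma_n(\hat\mu_n)$.
   Context: Hyperbolic space (Lorentz model): for $x,y\in\mathbb R^{d+1}$ let $\langle x,y\rangle_L=-x_0y_0+\sum_{j=1}^d x_jy_j$, and $\mathbb H^d=\{x\in\mathbb R^{d+1}:\langle x,x\rangle_L=-1,\ x_0>0\}$ with the Riemannian metric induced by $\langle\cdot,\cdot\rangle_L$ on tangent spaces and distance $\rho(x,y)=\operatorname{arcosh}(-\langle x,y\rangle_L)$. Let $o=(1,0,\dots,0)$. $\operatorname{Exp}_\mu:T_\mu\mathbb H^d\to\mathbb H^d$ is the Riemannian exponential map (a global diffeomorphism), $\operatorname{Log}_\mu$ its inverse, $PT_{x\to y}:T_x\mathbb H^d\to T_y\mathbb H^d$ parallel transport along the unique geodesic from $x$ to $y$. $T_o\mathbb H^d$ is identified with $\mathbb R^d$ by $(0,v)\leftrightarrow v$. Set $\mathsf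 T_\mu(x)=PT_{o\to\mu}^{-1}(\operatorname{Log}_\mu(x))\in\mathbb R^d$. $\mathcal S^{++}(d)$ is the set of real symmetric positive definite $d\times d$ matrices; $\preceq$ is the Loewner order. Let $\varphi:\mathbb R^d\to\mathbb R$, $\varphi(v)=\log(\sinh\|v\|/\|v\|)$ for $v\ne0$, $\varphi(0)=0$. Log-likelihood of the anisotropic hyperbolic wrapped normal model (up to an additive constant): $\ell_n(\mu,\Sigma)=\sum_{i=1}^n m_{\mu,\Sigma}(X_i)$, where $$m_{\mu,\Sigma}(x)=-\tfrac12\log\det\Sigma-\tfrac12\mathsf T_\mu(x)^\top\Sigma^{-1}\mathsf T_\mu(x)-(d-1)\varphi(\mathsf T_\mu(x)).$$ Let $S_n(\mu)=\frac1n\sum_{i=1}^n\mathsf T_\mu(X_i)\mathsf T_\mu(X_i)^\top$ and $\widetilde\Sigma_n(\mu)\in\operatorname{argmin}_{\Sigma\in\mathcal K}\{\log\det\Sigma+\operatorname{tr}(S_n(\mu)\Sigma^{-1})\}$. A shell-constrained profile MLE is a measurable (in the sample) maximizer $\hat\mu_n$ of $\mu\mapsto\ell_n(\mu,\widetilde\Sigma_n(\mu))$ over $\mathbb H^d$, together with $\hat\Sigma_n=\widetilde\Sigma_n(\hat\mu_n)$. *)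

(* Defs.v *)
From HB Require Import structures.
From mathcomp Require Import all_boot all_order all_algebra.
From mathcomp Require Import all_classical all_reals all_analysis.

Set Implicit Arguments.
Unset Strict Implicit.
Unset Printing Implicit Defensive.

Import Order.TTheory GRing.Theory Num.Theory.
Import numFieldNormedType.Exports.

Local Open Scope classical_set_scope.
Local Open Scope ring_scope.

Section optimization.
Context {R : realType} {T : Type}.

Definition argmax_on (A : set T) (f : T -> R) : set T :=
  [set x | A x /\ forall y, A y -> f y <= f x].

Definition argmin_on (A : set T) (f : T -> R) : set T :=
  [set x | A x /\ forall y, A y -> f x <= f y].

End optimization.

(* Points of R^(d+1) are column vectors; index ord0 is the time coordinate
   and the indices lift ord0 j, j : 'I_d, are the spatial ones. *)
Section hyperboloid.
Context {R : realType} {d : nat}.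
Implicit Types (x y p u v w : 'cV[R]_d.+1) (g V : R -> 'cV[R]_d.+1).

Definition lorentz x y : R :=
  - (x ord0 0 * y ord0 0) + \sum_(j < d) x (lift ord0 j) 0 * y (lift ord0 j) 0.

Definition hyperboloid : set 'cV[R]_d.+1 :=
  [set x | lorentz x x = -1 /\ 0 < x ord0 0].

Definition origin : 'cV[R]_d.+1 := delta_mx ord0 0.

Definition tangent p : set 'cV[R]_d.+1 := [set w | lorentz p w = 0].

(* The normal line of the hyperboloid at p is spanned by p, and
   lorentz p p = -1, so this is the orthogonal projection onto tangent p. *)
Definition tangent_proj p w : 'cV[R]_d.+1 := w + lorentz p w *: p.

(* Covariant derivative along g of the field V: the Levi-Civita connection of
   the metric induced on a nondegenerate submanifold of a flat space is the
   tangential part of the ambient derivative. *)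
Definition covariant_derive g V (t : R) : 'cV[R]_d.+1 :=
  tangent_proj (g t) (derive1 V t).

Definition geodesic g : Prop :=
  [/\ forall t, hyperboloid (g t),
      forall t, derivable g t 1,
      forall t, derivable (derive1 g) t 1 &
      forall t, covariant_derive g (derive1 g) t = 0].

Definition parallel_along g V : Prop :=
  [/\ forall t, tangent (g t) (V t),
      forall t, derivable V t 1 &
      forall t, covariant_derive g V t = 0].

(* The objects below are selected with get (unique choice): the sets are
   singletons for p, x, y on the hyperboloid and v, w tangent at p, x;
   otherwise the value is not meaningful. *)
Definition hexp p v : 'cV[R]_d.+1 :=
  get [set x | exists g,
    [/\ geodesic g, g 0 = p, derive1 g 0 = v & g 1 = x]].

Definition hlog p x : 'cV[R]_d.+1 :=
  get [set v | tangent p v /\ hexp p v = x].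

Definition ptransport x y w : 'cV[R]_d.+1 :=
  get [set u | exists g V,
    [/\ geodesic g, g 0 = x & g 1 = y] /\
    [/\ parallel_along g V, V 0 = w & V 1 = u]].

Definition tangent_at_origin (v : 'cV[R]_d) : 'cV[R]_d.+1 :=
  col_mx (0 : 'cV[R]_1) v.

Definition tangent_coord (mu x : 'cV[R]_d.+1) : 'cV[R]_d :=
  get [set v | ptransport origin mu (tangent_at_origin v) = hlog mu x].

End hyperboloid.

Section matrices.
Context {R : realType} {d : nat}.
Implicit Types (A B : 'M[R]_d) (v : 'cV[R]_d).

Definition quad_form A v : R := (v^T *m A *m v) 0 0.

Definition psd : set 'M[R]_d :=
  [set A | A^T = A /\ forall v, 0 <= quad_form A v].

Definition spd : set 'M[R]_d :=
  [set A | A^T = A /\ forall v, v != 0 -> 0 < quad_form A v].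

Definition loewner_le A B : Prop := psd (B - A).

Definition shell (lmin lmax : R) : set 'M[R]_d :=
  [set A | [/\ spd A, loewner_le lmin%:M A & loewner_le A lmax%:M]].

(* The norm `|v| of the library on matrices is the sup norm. *)
Definition euclid_norm v : R := Num.sqrt (\sum_(j < d) v j 0 ^+ 2).

End matrices.

Section wrapped_normal_model.
Context {R : realType} {d n : nat}.
Implicit Types (mu x : 'cV[R]_d.+1) (Sigma : 'M[R]_d).

Definition sinh (r : R) : R := (expR r - expR (- r)) / 2.

Definition log_sinhc (v : 'cV[R]_d) : R :=
  if v == 0 then 0 else ln (sinh (euclid_norm v) / euclid_norm v).

Definition log_density mu Sigma x : R :=
  - 2^-1 * ln (\det Sigma)
  - 2^-1 * quad_form (invmx Sigma) (tangent_coord mu x)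
  - (d%:R - 1) * log_sinhc (tangent_coord mu x).

(* A sample is the matrix whose columns are the observations. *)
Implicit Type X : 'M[R]_(d.+1, n).

Definition sample_space : set 'M[R]_(d.+1, n) :=
  [set X | forall i, hyperboloid (col i X)].

Definition loglik X mu Sigma : R := \sum_(i < n) log_density mu Sigma (col i X).

Definition scatter X mu : 'M[R]_d :=
  n%:R^-1 *:
    \sum_(i < n) tangent_coord mu (col i X) *m (tangent_coord mu (col i X))^T.

Definition cov_objective X mu Sigma : R :=
  ln (\det Sigma) + \tr (scatter X mu *m invmx Sigma).

Definition is_profile_cov (K : set 'M[R]_d)
    (Stilde : 'M[R]_(d.+1, n) -> 'cV[R]_d.+1 -> 'M[R]_d) : Prop :=
  forall X mu, sample_space X -> hyperboloid mu ->
    argmin_on K (cov_objective X mu) (Stilde X mu).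

(* Borel measurability on A, for the topology of the ambient matrix space. *)
Definition borel_measurable_on (T U : ptopologicalType) (A : set T)
    (f : T -> U) : Prop :=
  @measurable_fun _ _ (g_sigma_algebraType (@open T))
    (g_sigma_algebraType (@open U)) A f.

Definition is_profile_MLE
    (Stilde : 'M[R]_(d.+1, n) -> 'cV[R]_d.+1 -> 'M[R]_d)
    (muhat : 'M[R]_(d.+1, n) -> 'cV[R]_d.+1)
    (Sigmahat : 'M[R]_(d.+1, n) -> 'M[R]_d) : Prop :=
  [/\ borel_measurable_on sample_space muhat,
      forall X, sample_space X ->
        argmax_on hyperboloid (fun mu => loglik X mu (Stilde X mu)) (muhat X) &
      forall X, sample_space X -> Sigmahat X = Stilde X (muhat X)].

End wrapped_normal_model.

(* Main.v *)
(** On the hyperboloid the equations of geodesics and of parallel transport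
    are linear ODEs, since the speed of a geodesic and its Lorentz product with
    a parallel field are conserved. Solving them uniquely gives closed forms
    for the exponential map, its inverse and the transport, hence a formula for
    the coordinates T_mu(x) that is jointly continuous in (mu, x), with
    euclidean norm arcosh(-<mu, x>).

    On the shell, log det is bounded below and Sigma^-1 >= 1 / lmax, so the
    log-likelihood is at most c - d(mu, X_1)^2 / (2 lmax) and tends to -oo as
    mu leaves compact sets, uniformly for X in a compact set. This gives a
    joint maximizer. The maximizers of the profile likelihood contain the
    projection A(X) of the joint maximizers. The graph of A is closed and A is
    locally bounded, so {X | A(X) meets L} is a countable union of compact sets
    for every closed L; the lexicographically smallest element of A(X) is then
    a measurable selection. *)

Require Import Defs.
From mathcomp Require Import all_boot all_order all_algebra.
From mathcomp Require Import all_classical all_reals all_analysis.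
From mathcomp Require Import ring lra.

Set Implicit Arguments.
Unset Strict Implicit.
Unset Printing Implicit Defensive.

Import Order.TTheory GRing.Theory Num.Theory.
Import numFieldNormedType.Exports.

Local Open Scope classical_set_scope.
Local Open Scope ring_scope.

(** * Extrema of continuous functions on compact sets *)

Section optimization_on_compacts.
Context {R : realType}.

Lemma compact_argmin (T : topologicalType) (A : set T) (f : T -> R) :
  A !=set0 -> compact A -> {in A, continuous f} -> argmin_on A f !=set0.
Proof.
move=> A0 cA /continuous_in_subspaceT cf.
have [c /set_mem Ac fc] := compact_EVT_min A0 cA cf.
by exists c; split => // y Ay; apply: fc; exact: mem_set.
Qed.

Lemma compact_argmax (T : topologicalType) (A : set T) (f : T -> R) :
  A !=set0 -> compact A -> {in A, continuous f} -> argmax_on A f !=set0.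
Proof.
move=> A0 cA /continuous_in_subspaceT cf.
have [c /set_mem Ac fc] := compact_EVT_max A0 cA cf.
by exists c; split => // y Ay; apply: fc; exact: mem_set.
Qed.

(** Continuity of [h] is in the ambient topology, but only at points of [A]. A limit point lies in
    [A] because [A] is closed, and there [h < 0] would persist on a whole neighbourhood. *)
Lemma closed_ge0_in (T : topologicalType) (A : set T) (h : T -> R) :
  closed A -> {in A, continuous h} -> closed (A `&` [set x | 0 <= h x]).
Proof.
move=> clA ch x clx; have Ax : A x.
  by apply: clA => B /clx [y [[Ay _] By]]; exists y.
split=> //=; rewrite leNgt; apply/negP => hx.
have /clx : nbhs x (h @^-1` [set r | r < 0]).
  apply: ch; first exact: mem_set.
  by apply: (@open_nbhs_nbhs R (h x) [set r | r < 0]); split => //; exact: open_lt.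
by case=> y [[_ /= hy]]; rewrite /= ltNge hy.
Qed.

End optimization_on_compacts.

(** * Measurable selection by successive minimization of coordinates *)

Section lexicographic_selection.
Context {R : realType} {d : measure_display} {T : measurableType d}
  {U : ptopologicalType}.
Context (S : set T) (mS : measurable S).
Implicit Types (A : T -> set U) (c : U -> R).

Definition compact_valued A :=
  forall t, S t -> compact (A t) /\ A t !=set0.

(** Measurability of the set-valued map [A]; for singleton values it says that preimages of closed
    sets are measurable. *)
Definition closed_hitting_measurable A :=
  forall L, closed L -> measurable (S `&` [set t | A t `&` L !=set0]).

(* A t meets L at a minimizer of c iff min_(A t `&` L) c <= min_(A t) c, which
   is tested on rational levels of c. *)
Lemma argmin_hitting_measurable A c : continuous c ->
  compact_valued A -> closed_hitting_measurable A ->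
  compact_valued (fun t => argmin_on (A t) c) /\
  closed_hitting_measurable (fun t => argmin_on (A t) c).
Proof.
move=> cc cA mA.
have cle r : closed [set u | c u <= r].
  apply: (@closed_comp _ _ c [set x | x <= r]); last exact: closed_le.
  by move=> x _; exact: cc.
have cin (X : set U) : {in X, continuous c} by move=> x _; exact: cc.
split=> [t St|L clL].
  have [cAt A0] := cA _ St; have [m [Am mmin]] := compact_argmin A0 cAt (cin _).
  split; last by exists m.
  rewrite (_ : argmin_on _ _ = A t `&` [set u | c u <= c m]).
    exact: compact_closedI.
  apply/seteqP; split=> u [Au uP]; split => //; first exact: uP.
  by move=> y Ay; rewrite (le_trans uP) ?mmin.
pose hit q L := S `&` [set t | A t `&` (L `&` [set u | c u <= ratr q]) !=set0].
have mhit q L' : closed L' -> measurable (hit q L').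
  by move=> clL'; apply: mA; apply: closedI.
rewrite (_ : _ `&` _ = S `\` \bigcup_q (hit q setT `\` hit q L)); last first.
  apply/seteqP; split=> t.
    move=> [St [u [[Au umin] Lu]]]; split => // -[q _ [[_ [y [Ay [_ yq]]]]]].
    case; split => //; exists u; split => //; split => //=.
    by rewrite (le_trans _ yq) ?umin.
  move=> [St nhit]; split => //.
  have [cAt A0] := cA _ St; have [m [Am mmin]] := compact_argmin A0 cAt (cin _).
  have hitL (q : rat) : c m < ratr q -> A t `&` (L `&` [set u | c u <= ratr q]) !=set0.
    move=> mq; apply: contrapT => n; apply: nhit; exists q => //; split.
      by split => //; exists m; split => //; split => //=; exact: ltW.
    by case.
  (* Any rational level above [c m] shows that [A t] meets [L]; then [c] has a minimizer [v] on the
     intersection, and a rational strictly between [c m] and [c v] would contradict its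
     minimality. *)
  have [q /[!in_itv]/= /andP[mq _]] : exists q : rat, ratr q \in `](c m), (c m + 1)[.
    by apply: rat_in_itvoo; rewrite ltrDl.
  have AL0 : A t `&` L !=set0.
    by have [u [Au [Lu _]]] := hitL _ mq; exists u.
  have [v [[Av Lv] vmin]] := compact_argmin AL0 (compact_closedI cAt clL) (cin _).
  exists v; split => //; split => // y Ay; apply: le_trans (mmin _ Ay).
  rewrite leNgt; apply/negP => /rat_in_itvoo[q' /[!in_itv]/= /andP[mq' q'v]].
  have [u [Au [Lu uq']]] := hitL _ mq'.
  by have := vmin u (conj Au Lu); rewrite leNgt (le_lt_trans uq' q'v).
apply: measurableD => //; apply: bigcupT_measurable_rat => q.
by apply: measurableD; apply: mhit => //; exact: closedT.
Qed.

(** Each stage minimizes one more coordinate over the previous set. The new coordinate becomes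
    constant on the smaller set, and the earlier ones remain so. *)
Lemma lexicographic_hitting_measurable A (c : nat -> U -> R) n :
  (forall i, continuous (c i)) ->
  compact_valued A -> closed_hitting_measurable A ->
  exists B, [/\ forall t, B t `<=` A t, compact_valued B,
    closed_hitting_measurable B &
    forall t u v, B t u -> B t v -> forall i, (i < n)%N -> c i u = c i v].
Proof.
move=> cc cA mA; elim: n => [|n [B [BA cB mB Bc]]].
  by exists A; split => // t u v.
have [cB' mB'] := argmin_hitting_measurable (cc n) cB mB.
exists (fun t => argmin_on (B t) (c n)); split => //.
  by move=> t u [/BA].
move=> t u v [Bu umin] [Bv vmin] i; rewrite ltnS leq_eqVlt => /predU1P[->|].
  by apply/eqP; rewrite eq_le umin ?vmin.
exact: (Bc _ _ _ Bu Bv).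
Qed.

(** Since the [c i] separate points, the last set [B t] is a singleton, so the preimage of [L] under
    the selection is exactly the set where [B] hits [L]. *)
Lemma lexicographic_selection A (c : nat -> U -> R) n :
  (forall i, continuous (c i)) ->
  (forall u v, (forall i, (i < n)%N -> c i u = c i v) -> u = v) ->
  compact_valued A -> closed_hitting_measurable A ->
  exists f : T -> U, (forall t, S t -> A t (f t)) /\
    forall L, closed L -> measurable (S `&` f @^-1` L).
Proof.
move=> cc cinj cA mA.
have [B [BA cB mB Bc]] := lexicographic_hitting_measurable n cc cA mA.
have Bf t : S t -> B t (get (B t)) by move=> /cB[_ /getPex].
exists (fun t => get (B t)); split => [t /Bf /BA //|L clL].
rewrite (_ : _ `&` _ = S `&` [set t | B t `&` L !=set0]); first exact: mB.
apply/seteqP; split=> t [St].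
  by move=> Lt; split => //; exists (get (B t)); split => //; exact: Bf.
move=> [u [Bu Lu]]; split => //=.
by rewrite (_ : get (B t) = u) //; apply: cinj; apply: Bc Bu; exact: Bf.
Qed.

End lexicographic_selection.


Lemma closed_setX (T U : topologicalType) (A : set T) (B : set U) :
  closed A -> closed B -> closed (A `*` B).
Proof.
move=> clA clB; rewrite (_ : _ `*` _ = fst @^-1` A `&` snd @^-1` B) //.
apply: closedI; apply: closed_comp => // x _; [exact: cvg_fst|exact: cvg_snd].
Qed.

Lemma closed_measurable (T : ptopologicalType) (A : set T) :
  closed A -> measurable (A : set (g_sigma_algebraType (@open T))).
Proof.
move=> clA; rewrite -[A]setCK; apply: measurableC.
by apply: sub_sigma_algebra; rewrite /= openC.
Qed.

(** * Maximizers depending on a parameter *)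

Section parametric_argmax.
Context {R : realType} {T : ptopologicalType} {U W : topologicalType}.
Context (f : T -> U -> W -> R) (S : set T) (H : set U) (K : set W).
Hypothesis hausT : hausdorff_space T.
Hypotheses (clS : closed S) (clH : closed H) (clK : closed K) (cK : compact K).
(** Joint continuity in the ambient topology at points of [S], [H] and [K], phrased along arbitrary
    maps so that projections and constants can be plugged in directly. *)
Hypothesis cf : forall (I : topologicalType) (i : I) (t : I -> T) (u : I -> U)
    (w : I -> W), S (t i) -> H (u i) -> K (w i) ->
  {for i, continuous t} -> {for i, continuous u} -> {for i, continuous w} ->
  {for i, continuous (fun j => f (t j) (u j) (w j))}.
Context (u0 : U) (w0 : W) (Hu0 : H u0) (Kw0 : K w0).
(** The sets [D N] exhaust the parameters. For [t] in [D N], comparison with the reference point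
    [(u0, w0)] confines the maximizers to [C N]. *)
Context (D : nat -> set T) (C : nat -> set U).
Hypotheses (clD : forall N, closed (D N)) (cD : forall N, compact (D N)).
Hypothesis (DS : S `<=` \bigcup_N D N).
Hypotheses (clC : forall N, closed (C N)) (cC : forall N, compact (C N)).
Hypothesis coercive : forall N t u w, S t -> D N t -> H u -> K w -> ~ C N u ->
  f t u w < f t u0 w0.

Definition joint_argmax t : set (U * W) :=
  argmax_on (H `*` K) (fun z => f t z.1 z.2).

Definition partial_argmax t : set U := fst @` joint_argmax t.

Lemma joint_argmax_bounded N t z : S t -> D N t -> joint_argmax t z -> C N z.1.
Proof.
move=> St Dt [[Hz Kz] zmax]; apply: contrapT => nC.
by have := coercive St Dt Hz Kz nC; rewrite ltNge (zmax (u0, w0)).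
Qed.

(** Maximize over the compact part inside [C N]. It contains the reference point, whose value would
    otherwise be strictly below itself, and every point outside is beaten by that reference
    point. *)
Lemma joint_argmax_nonempty t : S t -> joint_argmax t !=set0.
Proof.
move=> St; have [N _ Dt] := DS St.
have Cu0 : C N u0.
  by apply: contrapT => /(coercive St Dt Hu0 Kw0); rewrite ltxx.
have cHCK : compact ((C N `&` H) `*` K).
  by apply: compact_setX => //; exact: compact_closedI.
have [||z [[[Cz Hz] Kz] zmax]] :=
  @compact_argmax R _ _ (fun z => f t z.1 z.2) _ cHCK.
- by exists (u0, w0).
- move=> z /set_mem [[Cz Hz] Kz]; apply: cf => //.
  + exact: cvg_cst.
  + exact: cvg_fst.
  + exact: cvg_snd.
exists z; split => // y [Hy Ky].
have [Cy|nC] := pselect (C N y.1); first exact: zmax.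
by apply: le_trans (ltW (coercive St Dt Hy Ky nC)) _; exact: (zmax (u0, w0)).
Qed.

(** Every competitor [y] contributes one closed inequality, so the graph is a closed subset of the
    compact set [Q]. *)
Lemma joint_argmax_graph_compact N L : closed L ->
  compact (((D N `&` S) `*` (C N `&` (H `&` L)) `*` K) `&`
     [set z | joint_argmax z.1.1 (z.1.2, z.2)]).
Proof.
move=> clL; set Q := _ `*` K.
have cQ : compact Q.
  apply: compact_setX => //; apply: compact_setX; first exact: compact_closedI.
  by apply: compact_closedI => //; exact: closedI.
have clQ : closed Q.
  by apply: closed_setX => //; apply: closed_setX; do ?apply: closedI.
(* [Q] is repeated inside the intersection because [f] is known to be continuous only over [S], [H]
   and [K], so the inequality is closed only relative to [Q]. *)
rewrite (_ : _ `&` _ = Q `&` \bigcap_(y in H `*` K)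
    (Q `&` [set z | 0 <= f z.1.1 z.1.2 z.2 - f z.1.1 y.1 y.2])); last first.
  apply/seteqP; split=> z [Qz Pz]; split => //.
    by move=> y HKy; split => //=; rewrite subr_ge0; case: Pz => _; exact.
  have [[_ [_ [Hz _]]] Kz] := Qz.
  by split => // y HKy; have [_] := Pz _ HKy; rewrite /= subr_ge0.
apply: compact_closedI => //; apply: closed_bigI => y [Hy Ky].
apply: closed_ge0_in => // z /set_mem [[[_ St] [_ [Hz _]]] Kz].
have cz11 : {for z, continuous (fun z : T * U * W => z.1.1)}.
  by apply: (@continuous_comp _ _ _ fst fst); exact: cvg_fst.
have cz12 : {for z, continuous (fun z : T * U * W => z.1.2)}.
  by apply: (@continuous_comp _ _ _ fst snd); [exact: cvg_fst|exact: cvg_snd].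
have cz2 : {for z, continuous (fun z : T * U * W => z.2)} by exact: cvg_snd.
have cy1 : {for z, continuous (fun _ : T * U * W => y.1)} by exact: cvg_cst.
have cy2 : {for z, continuous (fun _ : T * U * W => y.2)} by exact: cvg_cst.
have c1 := @cf _ z (fun z => z.1.1) (fun z => z.1.2) (fun z => z.2) St Hz Kz cz11 cz12 cz2.
have c2 := @cf _ z (fun z => z.1.1) (fun=> y.1) (fun=> y.2) St Hy Ky cz11 cy1 cy2.
exact: (continuousB c1 c2).
Qed.

(** This is the projection of the compact graph to the parameter; by [joint_argmax_bounded] the
    restriction to [C N] loses no maximizer. *)
Lemma partial_argmax_hitting_compact N L : closed L ->
  compact (D N `&` S `&` [set t | partial_argmax t `&` L !=set0]).
Proof.
move=> clL; rewrite (_ : _ `&` _ = (fun z => z.1.1) @`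
  (((D N `&` S) `*` (C N `&` (H `&` L)) `*` K) `&`
     [set z | joint_argmax z.1.1 (z.1.2, z.2)])).
  apply: continuous_compact; last exact: joint_argmax_graph_compact.
  apply: continuous_subspaceT => z.
  by apply: (@continuous_comp _ _ _ fst fst); exact: cvg_fst.
apply/seteqP; split=> t.
  move=> [[Dt St] [_ [[[u w] tuw <-] Lu]]]; exists (t, u, w) => //.
  have [[Hu Kw] _] := tuw; split => //; split => //; split => //; split => //.
  exact: (joint_argmax_bounded St Dt tuw).
move=> [[[t' u] w] [[[[Dt St] [Cu [Hu Lu]]] Kw] tuw] <-]; split => //.
by exists u; split => //; exists (u, w).
Qed.

Lemma partial_argmax_compact t : S t -> compact (partial_argmax t).
Proof.
move=> St; have [N _ Dt] := DS St.
(* The slice over [t] of the compact graph, with [L] the whole space; the singleton of [t] is closed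
   by the Hausdorff property. *)
rewrite (_ : partial_argmax t = (fun z => z.1.2) @`
  ((((D N `&` S) `*` (C N `&` (H `&` setT)) `*` K) `&`
     [set z | joint_argmax z.1.1 (z.1.2, z.2)]) `&` [set z | z.1.1 = t])).
  apply: continuous_compact; last first.
    apply: compact_closedI; first by apply: joint_argmax_graph_compact; exact: closedT.
    apply: (@closed_comp _ _ (fun z : T * U * W => z.1.1) [set t]).
      by move=> z _; apply: (@continuous_comp _ _ _ fst fst); exact: cvg_fst.
    exact: accessible_closed_set1 (hausdorff_accessible hausT) _.
  apply: continuous_subspaceT => z.
  by apply: (@continuous_comp _ _ _ fst snd); [exact: cvg_fst|exact: cvg_snd].
apply/seteqP; split=> u.
  move=> [[u' w] tuw <-]; exists (t, u', w) => //; split => //.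
  have [[Hu Kw] _] := tuw; split => //; split => //; split => //; split => //.
  exact: (joint_argmax_bounded St Dt tuw).
by move=> [[[t' u'] w] [[_ tuw] /= tt'] <-]; exists (u', w) => //; rewrite -tt'.
Qed.

End parametric_argmax.

Section measurable_argmax.
Context {R : realType} {T U : ptopologicalType} {W : topologicalType}.
Context (f : T -> U -> W -> R) (S : set T) (H : set U) (K : set W).
Hypothesis hausT : hausdorff_space T.
Hypotheses (clS : closed S) (clH : closed H) (clK : closed K) (cK : compact K).
Hypothesis cf : forall (I : topologicalType) (i : I) (t : I -> T) (u : I -> U)
    (w : I -> W), S (t i) -> H (u i) -> K (w i) ->
  {for i, continuous t} -> {for i, continuous u} -> {for i, continuous w} ->
  {for i, continuous (fun j => f (t j) (u j) (w j))}.
Context (u0 : U) (w0 : W) (Hu0 : H u0) (Kw0 : K w0).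
Context (D : nat -> set T) (C : nat -> set U).
Hypotheses (clD : forall N, closed (D N)) (cD : forall N, compact (D N)).
Hypothesis (DS : S `<=` \bigcup_N D N).
Hypotheses (clC : forall N, closed (C N)) (cC : forall N, compact (C N)).
Hypothesis coercive : forall N t u w, S t -> D N t -> H u -> K w -> ~ C N u ->
  f t u w < f t u0 w0.
Context (c : nat -> U -> R) (n : nat).
Hypothesis cc : forall i, continuous (c i).
Hypothesis cinj : forall u v, (forall i, (i < n)%N -> c i u = c i v) -> u = v.

Lemma measurable_partial_argmax : exists g : T -> U,
  borel_measurable_on S g /\ forall t, S t -> partial_argmax f H K t (g t).
Proof.
have mS : measurable (S : set (g_sigma_algebraType (@open T))).
  exact: closed_measurable.
have [t St||g [gA gm]] := @lexicographic_selection R _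
   (g_sigma_algebraType (@open T)) U S mS (partial_argmax f H K) c n cc cinj.
- split.
    exact: (partial_argmax_compact hausT clS clH clK cK cf Hu0 Kw0 clD cD DS clC
      cC coercive).
  have [z tz] := joint_argmax_nonempty clH cK cf Hu0 Kw0 DS cC coercive St.
  by exists z.1, z.
(* The hitting set is a countable union over [N] of compact, hence closed, sets. *)
- move=> L clL; rewrite (_ : _ `&` _ = \bigcup_N
      (D N `&` S `&` [set t | partial_argmax f H K t `&` L !=set0])).
    apply: bigcupT_measurable => N; apply: closed_measurable.
    apply: compact_closed => //.
    exact: (partial_argmax_hitting_compact clS clH clK cK cf Hu0 Kw0 clD cD clC
      cC coercive).
  apply/seteqP; split=> [t [St At]|t [N _ [[_ St] At]]//].
  by have [N _ Dt] := DS St; exists N.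
exists g; split => //.
rewrite /borel_measurable_on.
(* It suffices to test open sets, whose preimages are the complements in [S] of preimages of closed
   sets. *)
apply: (@measurability _ _ (g_sigma_algebraType (@open T))
  (g_sigma_algebraType (@open U)) S g (@open U)) => //.
move=> _ [V opV <-].
have -> : S `&` g @^-1` V = S `\` (S `&` g @^-1` (~` V)).
  apply/seteqP; split=> t [St gt]; split => //; first by case.
  by apply: contrapT => nO; apply: gt.
by apply: measurableD => //; apply: gm; rewrite closedC.
Qed.

End measurable_argmax.

(** * Hyperbolic functions and their inverses *)

Section hyperbolic_functions.
Context {R : realType}.
Implicit Types (r t : R).

Definition cosh r : R := (expR r + expR (- r)) / 2.

(** The removable singularity at 0 is filled continuously, so the logarithm map and [log_sinhc] can
    be written without a case distinction. *)
Definition sinhc r : R := if r == 0 then 1 else sinh r / r.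

Definition arcosh r : R := ln (r + Num.sqrt (r ^+ 2 - 1)).

Lemma cosh0 : cosh 0 = 1.
Proof. by rewrite /cosh oppr0 expR0; field. Qed.

Lemma sinh0 : sinh 0 = 0 :> R.
Proof. by rewrite /sinh oppr0 expR0 subrr mul0r. Qed.

Lemma cosh2_sinh2 r : cosh r ^+ 2 = 1 + sinh r ^+ 2.
Proof.
rewrite /cosh /sinh; have := expRxMexpNx_1 r.
by move: (expR r) (expR (- r)) => a b ab; field: ab.
Qed.

Lemma cosh_ge1 r : 1 <= cosh r.
Proof.
have h : 0 < cosh r by rewrite divr_gt0 // addr_gt0 // expR_gt0.
by rewrite -(@ler_pXn2r _ 2) ?nnegrE ?(ltW h) // expr1n cosh2_sinh2 lerDl sqr_ge0.
Qed.

Let scalerE (a b : R) : a *: b = a * b. Proof. by []. Qed.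

Lemma is_derive_expRMl (c t : R) :
  is_derive t 1 (fun t => expR (c * t)) (c * expR (c * t)).
Proof.
have d : is_derive t 1 (fun t : R => c * t) (c * 1).
  exact: (is_deriveZ c (is_derive_id t (1 : R))).
have := @is_derive1_comp _ expR (fun t => c * t) t _ _ (is_derive_expR _) d.
by rewrite mulr1 mulrC.
Qed.

Lemma is_derive_coshMl (c t : R) :
  is_derive t 1 (fun t => cosh (c * t)) (c * sinh (c * t)).
Proof.
have d1 := is_derive_expRMl c t; have d2 := is_derive_expRMl (- c) t.
have := is_deriveZ 2^-1 (is_deriveD d1 d2).
rewrite [X in is_derive _ _ X](_ : _ = (fun t => cosh (c * t))); last first.
  by apply/funext => s; rewrite /cosh !fctE /= mulNr /GRing.scale /= mulrC.
move=> /is_derive_eq; apply.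
by rewrite /sinh scalerE !mulNr; field.
Qed.

Lemma is_derive_sinhMl (c t : R) :
  is_derive t 1 (fun t => sinh (c * t)) (c * cosh (c * t)).
Proof.
have d1 := is_derive_expRMl c t; have d2 := is_derive_expRMl (- c) t.
have := is_deriveZ 2^-1 (is_deriveB d1 d2).
rewrite [X in is_derive _ _ X](_ : _ = (fun t => sinh (c * t))); last first.
  by apply/funext => s; rewrite /sinh !fctE /= mulNr /GRing.scale /= mulrC.
move=> /is_derive_eq; apply.
by rewrite /cosh scalerE !mulNr; field.
Qed.

Lemma is_derive_sinh r : is_derive r 1 (@sinh R) (cosh r).
Proof.
have := is_derive_sinhMl 1 r; rewrite !mul1r.
by under [X in is_derive _ _ X]eq_fun do rewrite mul1r.
Qed.

Lemma sinh_ge r : 0 <= r -> r <= sinh r.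
Proof.
move=> r0.
pose f : R -> R := sinh - id.
have D t : is_derive t 1 f (cosh t - 1).
  exact: is_deriveB (is_derive_sinh t) (is_derive_id t (1 : R)).
have df t : derivable f t 1 by have [] := D t.
have f'_ge0 t : 0 <= derive1 f t.
  by rewrite derive1E; have [_ ->] := D t; rewrite subr_ge0 cosh_ge1.
have cf : {within `[0, r], continuous f}.
  by apply: derivable_within_continuous => t _; exact: df.
have := ger0_derive1_ndecr (fun t _ => df t) (fun t _ => f'_ge0 t) cf
  (lexx 0) r0 (lexx r).
by rewrite /f !fctE /= sinh0 subrr subr_ge0.
Qed.

Lemma sinhc_ge1 r : 0 <= r -> 1 <= sinhc r.
Proof.
rewrite /sinhc; case: eqVneq => // r0 rge0.
by rewrite ler_pdivlMr ?lt_def ?r0 // mul1r sinh_ge.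
Qed.

Lemma sinhcM r : sinhc r * r = sinh r.
Proof.
by rewrite /sinhc; case: eqVneq => [->|r0]; rewrite ?mulr0 ?sinh0 // divfK.
Qed.

Lemma sinhc_continuous : continuous sinhc.
Proof.
move=> r; have [->|r0] := eqVneq r 0.
  (* Away from 0, [sinhc] is the difference quotient of [sinh] at 0, which tends to [cosh 0 = 1]. *)
  apply/continuous_withinNx; rewrite /sinhc eqxx.
  have [+ D] := is_derive_sinh 0; rewrite cosh0 in D.
  rewrite /derivable; move: D; rewrite /derive => D dv.
  have := dv; rewrite /= D => {dv}.
  apply: cvg_trans; apply: near_eq_cvg; near=> h.
  have h0 : h != 0 by near: h; exact: nbhs_dnbhs_neq.
  by rewrite (negbTE h0) /= addr0 sinh0 subr0 /GRing.scale /= mulr1 mulrC.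
have sc : {for r, continuous sinh}.
  have [d _] := is_derive_sinh r.
  by apply/differentiable_continuous/derivable1_diffP.
rewrite /continuous_at /sinhc (negbTE r0).
have : (fun t => sinh t / t) x @[x --> r] --> sinh r / r.
  by apply: cvgM => //; apply: cvgV.
apply: cvg_trans; apply: near_eq_cvg.
have : \forall t \near r, t != 0.
  by apply: (@open_nbhs_nbhs R r [set x | x != 0]); split => //; exact: open_neq.
by apply: filterS => t /negbTE ->.
Unshelve. all: by end_near. Qed.

Lemma cosh_arcosh r : 1 <= r -> cosh (arcosh r) = r.
Proof.
move=> r1; have s0 : 0 <= r ^+ 2 - 1 by
  rewrite subr_ge0 expr_ge1 // ltW // (lt_le_trans _ r1).
rewrite /cosh /arcosh expRN lnK ?posrE ?ltr_wpDr ?sqrtr_ge0 ?(lt_le_trans _ r1) //.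
(* With [s ^+ 2 = r ^+ 2 - 1], the inverse of [r + s] is [r - s]. *)
have := sqr_sqrtr s0; have := sqrtr_ge0 (r ^+ 2 - 1).
move: (Num.sqrt _) => s s_ge0 sE.
have : r + s != 0 by rewrite gt_eqF // ltr_wpDr // (lt_le_trans _ r1).
by move=> ?; field: sE.
Qed.

Lemma arcosh_ge0 r : 1 <= r -> 0 <= arcosh r.
Proof. by move=> r1; rewrite ln_ge0 // ler_wpDr // sqrtr_ge0. Qed.

Lemma arcosh_ge_ln r : 1 <= r -> ln r <= arcosh r.
Proof.
move=> r1; have r0 : 0 < r by apply: lt_le_trans r1.
by rewrite ler_ln ?posrE ?ltr_wpDr ?sqrtr_ge0 // lerDl sqrtr_ge0.
Qed.

Lemma coshK r : 0 <= r -> arcosh (cosh r) = r.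
Proof.
move=> r0; rewrite /arcosh cosh2_sinh2 (addrC 1) addrK sqrtr_sqr ger0_norm; last first.
  exact: le_trans r0 (sinh_ge r0).
by rewrite /cosh /sinh (_ : _ + _ = expR r) ?expRK //; field.
Qed.

(** Below 1 the square root of a negative number is 0 by convention, so [arcosh] coincides with [ln]
    there. Continuity at 1 is thus two-sided, as required at points of the hyperboloid seen in the
    ambient space. *)
Lemma arcosh_continuous r : 0 < r -> {for r, continuous arcosh}.
Proof.
move=> r0; have c1 : {for r, continuous (fun r : R => r ^+ 2 - 1)}.
  by apply: cvgB; [exact: exprn_continuous|exact: cvg_cst].
have c2 : {for r, continuous (fun r : R => r + Num.sqrt (r ^+ 2 - 1))}.
  apply: cvgD => //; apply: (continuous_comp c1); exact: sqrt_continuous.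
apply: (continuous_comp c2).
by apply: continuous_ln; rewrite ltr_wpDr ?sqrtr_ge0.
Qed.

End hyperbolic_functions.

(** The second-order operator factors: [v = u' - c * u] satisfies [v' = - c * v], so it vanishes,
    and then [u' = c * u] forces [u = 0]. *)
Lemma ode_exp_unique {R : realType} (c : R) (u u' : R -> R) :
  (forall t : R, is_derive t 1 u (u' t)) ->
  (forall t : R, is_derive t 1 u' (c ^+ 2 * u t)) ->
  u 0 = 0 -> u' 0 = 0 -> forall t, u t = 0.
Proof.
move=> du du' u0 u'0 t.
have first_order a (f : R -> R) : (forall s : R, is_derive s 1 f (a * f s)) ->
    f 0 = 0 -> forall s, f s = 0.
  move=> df f0 s.
  (* Integrating factor: this product has zero derivative. *)
  have : expR (- a * s) * f s = expR (- a * 0) * f 0.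
    apply: (@is_derive_0_is_cst R ((fun s => expR (- a * s)) * f)) => z.
    have := is_deriveM (is_derive_expRMl (- a) z) (df z).
    by move=> /is_derive_eq; apply; rewrite /GRing.scale /=; ring.
  by rewrite f0 mulr0 => /eqP; rewrite mulf_eq0 expR_eq0 /= => /eqP.
have v0 : forall s, u' s - c * u s = 0.
  apply: (first_order (- c) (fun s => u' s - c * u s)).
    move=> s; have := is_deriveB (du' s) (is_deriveZ c (du s)).
    by move=> /is_derive_eq; apply; rewrite /GRing.scale /=; ring.
  by rewrite u0 u'0 mulr0 subrr.
apply: (first_order c u) => // s.
by move: (v0 s) => /eqP; rewrite subr_eq0 => /eqP <-; exact: du.
Qed.

(** * Lorentz geometry of the hyperboloid *)

Section lorentz_form.
Context {R : realType} {d : nat}.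
Implicit Types (x y p q u v w : 'cV[R]_d.+1) (a : R).

Lemma lorentzC x y : lorentz x y = lorentz y x.
Proof.
by rewrite /lorentz mulrC; congr (_ + _); apply: eq_bigr => j _; rewrite mulrC.
Qed.

Lemma lorentzDr x y w : lorentz x (y + w) = lorentz x y + lorentz x w.
Proof.
rewrite /lorentz mxE mulrDr opprD addrACA; congr (_ + _).
by rewrite -big_split; apply: eq_bigr => j _; rewrite mxE mulrDr.
Qed.

Lemma lorentzZr x a y : lorentz x (a *: y) = a * lorentz x y.
Proof.
rewrite /lorentz mxE mulrDr mulr_sumr mulrN mulrCA; congr (_ + _).
by apply: eq_bigr => j _; rewrite mxE mulrCA.
Qed.

Lemma lorentzDl x y w : lorentz (x + y) w = lorentz x w + lorentz y w.
Proof. by rewrite lorentzC lorentzDr !(lorentzC w). Qed.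

Lemma lorentzZl x a y : lorentz (a *: x) y = a * lorentz x y.
Proof. by rewrite lorentzC lorentzZr lorentzC. Qed.

Lemma lorentzNr x y : lorentz x (- y) = - lorentz x y.
Proof. by rewrite -scaleN1r lorentzZr mulN1r. Qed.

Lemma lorentzNl x y : lorentz (- x) y = - lorentz x y.
Proof. by rewrite lorentzC lorentzNr lorentzC. Qed.

Lemma lorentz0r x : lorentz x 0 = 0.
Proof. by rewrite -(scale0r 0) lorentzZr mul0r. Qed.

Definition lorentzE := (lorentzDl, lorentzDr, lorentzZl, lorentzZr, lorentzNl,
  lorentzNr).

Lemma lorentz_origin x : lorentz origin x = - x ord0 0.
Proof.
rewrite /lorentz /origin mxE !eqxx mul1r big1 ?addr0 // => j _.
by rewrite mxE /= mul0r.
Qed.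

Lemma origin_hyperboloid : hyperboloid (origin : 'cV[R]_d.+1).
Proof. by split; rewrite ?lorentz_origin mxE !eqxx. Qed.

Definition spatial x : 'cV[R]_d := \col_j x (lift ord0 j) 0.

Lemma tangent_at_originE (v : 'cV[R]_d) j :
  tangent_at_origin v (lift ord0 j) 0 = v j 0.
Proof.
(* The block rule uses [rshift]; the two indices agree by value. *)
rewrite /tangent_at_origin -(@col_mxEd _ 1 d 1 0 v).
by congr (col_mx _ _ _ _); apply: val_inj.
Qed.

Lemma tangent_at_origin0 (v : 'cV[R]_d) : tangent_at_origin v ord0 0 = 0.
Proof.
have <- : (0 : 'cV[R]_1) 0 0 = 0 by rewrite mxE.
rewrite -(@col_mxEu _ 1 d 1 0 v).
by congr (col_mx _ _ _ _); apply: val_inj.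
Qed.

Lemma tangent_at_originP (v : 'cV[R]_d) : tangent origin (tangent_at_origin v).
Proof. by rewrite /tangent /= lorentz_origin tangent_at_origin0 oppr0. Qed.

Lemma tangent_at_originK : cancel (@tangent_at_origin R d) spatial.
Proof.
by move=> v; apply/matrixP => i j; rewrite mxE tangent_at_originE ord1.
Qed.

Lemma spatialK w : tangent origin w -> tangent_at_origin (spatial w) = w.
Proof.
rewrite /tangent /= lorentz_origin => /eqP; rewrite oppr_eq0 => /eqP w0.
apply/matrixP => i j; rewrite ord1.
have [i'|->] := unliftP ord0 i; last by rewrite tangent_at_origin0 w0.
by move=> ->; rewrite tangent_at_originE mxE.
Qed.

Lemma euclid_normE w : tangent origin w ->
  euclid_norm (spatial w) = Num.sqrt (lorentz w w).
Proof.
rewrite /tangent /= lorentz_origin => /eqP; rewrite oppr_eq0 => /eqP w0.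
rewrite /euclid_norm /lorentz w0 mul0r oppr0 add0r; congr Num.sqrt.
by apply: eq_bigr => j _; rewrite mxE expr2.
Qed.

Lemma lorentz_ge0_origin w : tangent origin w -> 0 <= lorentz w w.
Proof.
rewrite /tangent /= lorentz_origin => /eqP; rewrite oppr_eq0 => /eqP w0.
rewrite /lorentz w0 mul0r oppr0 add0r; apply: sumr_ge0 => j _.
by rewrite -expr2 sqr_ge0.
Qed.

Lemma lorentz_eq0_origin w : tangent origin w -> lorentz w w = 0 -> w = 0.
Proof.
rewrite /tangent /= lorentz_origin => /eqP; rewrite oppr_eq0 => /eqP w0.
rewrite /lorentz w0 mul0r oppr0 add0r => /eqP; rewrite psumr_eq0; last first.
  by move=> j _; rewrite -expr2 sqr_ge0.
move=> /allP W; apply/matrixP => i j; rewrite ord1 mxE.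
have [i' ->|->] := unliftP ord0 i; last by rewrite w0.
have /eqP := W i' (mem_index_enum _); rewrite /= => /eqP.
by rewrite mulf_eq0 orbb => /eqP.
Qed.

(* Expand 0 <= <w, w> for w := p / p_0 - q / q_0, tangent at the origin. *)
Lemma lorentz_hyperboloid_ge p q : hyperboloid p -> hyperboloid q ->
  (p ord0 0 / q ord0 0) / 2 <= - lorentz p q.
Proof.
move=> [pp p0] [qq q0].
have tw : tangent origin ((p ord0 0)^-1 *: p - (q ord0 0)^-1 *: q).
  rewrite /tangent /= !lorentzE !lorentz_origin !mulrN !mulVf ?gt_eqF //.
  by rewrite opprK addNr.
have := lorentz_ge0_origin tw; rewrite !lorentzE pp qq (lorentzC q p).
move: (lorentz p q) => l; set a := p ord0 0 in p0 *; set b := q ord0 0 in q0 *.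
move=> h; have : 0 <= a * b * (- l * 2 / (a * b) - 1 / a ^+ 2 - 1 / b ^+ 2).
  rewrite mulr_ge0 ?mulr_ge0 ?(ltW p0) ?(ltW q0) //.
  by move: h; congr (_ <= _); field; rewrite !gt_eqF.
have -> : a * b * (- l * 2 / (a * b) - 1 / a ^+ 2 - 1 / b ^+ 2) =
    2 * (- l) - b / a - a / b by field; rewrite !gt_eqF.
have : 0 <= b / a by rewrite divr_ge0 // ltW.
move: (a / b) (b / a) => x y; lra.
Qed.

Lemma lorentz_hyperboloid_lt0 p q : hyperboloid p -> hyperboloid q ->
  lorentz p q < 0.
Proof.
move=> hp hq; rewrite -oppr_gt0; apply: lt_le_trans (lorentz_hyperboloid_ge hp hq).
by rewrite !divr_gt0 //; [case: hp|case: hq].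
Qed.

(** If the time coordinate of [x] were negative, [- x] would lie on the hyperboloid and have the
    wrong sign against [p]; if it were zero, [x] would be tangent at the origin, with nonnegative
    square. *)
Lemma future_hyperboloid p x : hyperboloid p -> lorentz x x = -1 ->
  lorentz p x < 0 -> hyperboloid x.
Proof.
move=> hp xx px; split => //; have [//|x0|x0] := ltgtP 0 (x ord0 0).
  have hx : hyperboloid (- x).
    by split; rewrite ?mxE ?oppr_gt0 // lorentzNl lorentzNr opprK.
  have := lorentz_hyperboloid_lt0 hp hx; rewrite lorentzNr oppr_lt0.
  by move=> /(lt_trans px); rewrite ltxx.
have : tangent origin x by rewrite /tangent /= lorentz_origin -x0 oppr0.
by move=> /lorentz_ge0_origin; rewrite xx ler0N1.
Qed.

(* Closed form of the parallel transport from p to q, see [ptransportE]. *)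
Definition transport p q w : 'cV[R]_d.+1 :=
  w + (lorentz q w / (1 - lorentz p q)) *: (p + q).

Lemma transport_denom p q : hyperboloid p -> hyperboloid q ->
  1 - lorentz p q != 0.
Proof.
by move=> hp hq; rewrite gt_eqF // subr_gt0 (lt_trans (lorentz_hyperboloid_lt0 hp hq)).
Qed.

Lemma transport_tangent p q w : hyperboloid p -> hyperboloid q ->
  tangent p w -> tangent q (transport p q w).
Proof.
move=> hp hq; have := transport_denom hp hq; case: hp hq => pp _ [qq _].
rewrite /tangent /transport /= !lorentzE qq (lorentzC q p).
by move=> ? pw; field.
Qed.

Lemma transport_isometry p q v w : hyperboloid p -> hyperboloid q ->
  tangent p v -> tangent p w ->
  lorentz (transport p q v) (transport p q w) = lorentz v w.
Proof.
move=> hp hq; have := transport_denom hp hq; case: hp hq => pp _ [qq _].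
rewrite /tangent /transport /= !lorentzE pp qq (lorentzC q p) (lorentzC v p)
  (lorentzC v q).
by move=> ? -> ->; field.
Qed.

Lemma transportK p q w : hyperboloid p -> hyperboloid q ->
  tangent p w -> transport q p (transport p q w) = w.
Proof.
move=> hp hq; have := transport_denom hp hq; case: hp hq => pp _ [qq _].
rewrite /tangent /transport /= !lorentzE pp (lorentzC q p) => h pw.
rewrite pw (addrC q) -addrA -scalerDl [X in _ + X *: _ = _](_ : _ = 0).
  by rewrite scale0r addr0.
by field.
Qed.

(** Transport to the origin is an isometry, and there the form on tangent vectors is Euclidean. *)
Lemma tangent_lorentz_ge0 p w : hyperboloid p -> tangent p w ->
  0 <= lorentz w w.
Proof.
move=> hp tw; have ho := origin_hyperboloid.
rewrite -(transport_isometry hp ho tw tw).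
exact: lorentz_ge0_origin (transport_tangent hp ho tw).
Qed.

Lemma tangent_lorentz_eq0 p w : hyperboloid p -> tangent p w ->
  lorentz w w = 0 -> w = 0.
Proof.
move=> hp tw ww; have ho := origin_hyperboloid.
rewrite -(transportK hp ho tw) (lorentz_eq0_origin (transport_tangent hp ho tw)).
  by rewrite /transport lorentz0r mul0r scale0r addr0.
by rewrite transport_isometry.
Qed.

(** The tangential part of [q] at [p]. Its square is nonnegative, which gives the reversed
    Cauchy-Schwarz inequality; its length is the hyperbolic sine of the distance. *)
Lemma lorentz_projection p q : hyperboloid p -> hyperboloid q ->
  tangent p (q + lorentz p q *: p) /\
  lorentz (q + lorentz p q *: p) (q + lorentz p q *: p) = lorentz p q ^+ 2 - 1.
Proof.
move=> [pp _] [qq _]; rewrite /tangent /= !lorentzE pp qq (lorentzC q p).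
by split; ring.
Qed.

Lemma lorentz_hyperboloid_le p q : hyperboloid p -> hyperboloid q ->
  1 <= - lorentz p q.
Proof.
move=> hp hq; have [t e] := lorentz_projection hp hq.
have := tangent_lorentz_ge0 hp t; rewrite e subr_ge0 => h.
rewrite -(@ler_pXn2r _ 2) ?nnegrE ?expr1n ?sqrrN //.
by rewrite oppr_ge0 ltW ?lorentz_hyperboloid_lt0.
Qed.

End lorentz_form.

(** * Geodesics as solutions of a linear equation *)

Section curves.
Context {R : realType} {d : nat}.
Implicit Types (p q v w : 'cV[R]_d.+1) (g V : R -> 'cV[R]_d.+1) (t : R).

Lemma is_derive_mxP (m n : nat) (M : R -> 'M[R]_(m, n)) t dM :
  is_derive t 1 M dM <-> forall i j, is_derive t 1 (fun s => M s i j) (dM i j).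
Proof.
split=> [[dv <-] i j|H].
  rewrite derive_mx // mxE; apply: derivableP.
  by move/derivable_mxP : dv; exact.
have dv : derivable M t 1 by apply/derivable_mxP => i j; have [] := H i j.
split => //; rewrite derive_mx //; apply/matrixP => i j; rewrite mxE.
by have [_ ->] := H i j.
Qed.

Lemma is_derive_scalel (a : R -> R) (w : 'cV[R]_d.+1) t da :
  is_derive t 1 a da -> is_derive t 1 (fun s => a s *: w) (da *: w).
Proof.
move=> Da; apply/is_derive_mxP => i j; rewrite mxE mulrC.
rewrite (_ : (fun s => _) = w i j \*: a); first exact: is_deriveZ.
by apply/funext => s; rewrite mxE mulrC.
Qed.

Lemma is_derive_lorentz g V t dg dV :
  is_derive t 1 g dg -> is_derive t 1 V dV ->
  is_derive t 1 (fun s => lorentz (g s) (V s)) (lorentz dg (V t) + lorentz (g t) dV).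
Proof.
move=> /is_derive_mxP Dg /is_derive_mxP DV.
have D0 := is_deriveN (is_deriveM (Dg ord0 0) (DV ord0 0)).
have DS := is_derive_sum (fun j : 'I_d =>
  is_deriveM (Dg (lift ord0 j) 0) (DV (lift ord0 j) 0)).
have := is_deriveD D0 DS.
rewrite [X in is_derive _ _ X](_ : _ = (fun s => lorentz (g s) (V s))); last first.
  by apply/funext => s; rewrite /lorentz !fctE fct_sumE.
move=> /is_derive_eq; apply.
rewrite /lorentz addrACA -opprD -big_split /=; congr (- _ + _).
  by rewrite /GRing.scale /=; ring.
by apply: eq_bigr => j _; rewrite /GRing.scale /=; ring.
Qed.

Lemma is_derive_lorentz_cst g V t dg dV (c : R) :
  is_derive t 1 g dg -> is_derive t 1 V dV ->
  (forall s, lorentz (g s) (V s) = c) ->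
  lorentz dg (V t) + lorentz (g t) dV = 0.
Proof.
move=> Dg DV gV; have := is_derive_lorentz Dg DV.
rewrite [X in is_derive _ _ X](_ : _ = cst c); last exact/funext.
by move=> [_]; rewrite derive_cst.
Qed.

Lemma hyperboloid_velocity g t dg : (forall s, hyperboloid (g s)) ->
  is_derive t 1 g dg -> lorentz (g t) dg = 0.
Proof.
move=> hg Dg; have /eqP := is_derive_lorentz_cst Dg Dg (fun s => (hg s).1).
by rewrite (lorentzC dg) -mulr2n mulrn_eq0 /= => /eqP.
Qed.

Lemma derive1P g t : derivable g t 1 -> is_derive t 1 g (derive1 g t).
Proof. by move=> dg; rewrite derive1E; exact: derivableP. Qed.

Lemma is_derive_derive1 g t dg : is_derive t 1 g dg -> derive1 g t = dg.
Proof. by rewrite derive1E => -[_ ->]. Qed.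

(* For v = 0 the quotient is 0 (division by 0) and the curve is constant. *)
Definition geodesic_curve p v t : 'cV[R]_d.+1 :=
  let r := Num.sqrt (lorentz v v) in cosh (r * t) *: p + (sinh (r * t) / r) *: v.

Definition geodesic_velocity p v t : 'cV[R]_d.+1 :=
  let r := Num.sqrt (lorentz v v) in (r * sinh (r * t)) *: p + cosh (r * t) *: v.

Section tangent_vector.
Context p v (hp : hyperboloid p) (tv : tangent p v).
Let r := Num.sqrt (lorentz v v).

Let r2 : r ^+ 2 = lorentz v v.
Proof. by rewrite sqr_sqrtr // (tangent_lorentz_ge0 hp). Qed.

Let r0 : r = 0 -> v = 0.
Proof.
by move=> r0; apply: (tangent_lorentz_eq0 hp tv); rewrite -r2 r0 expr2 mul0r.
Qed.

Lemma geodesic_curve_deriv t :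
  is_derive t 1 (geodesic_curve p v) (geodesic_velocity p v t).
Proof.
have d1 := is_derive_scalel p (is_derive_coshMl r t).
have d2 := is_derive_scalel (r^-1 *: v) (is_derive_sinhMl r t).
have := is_deriveD d1 d2.
rewrite [X in is_derive _ _ X](_ : _ = geodesic_curve p v); last first.
  by apply/funext => s; rewrite /geodesic_curve !fctE -/r scalerA.
move=> /is_derive_eq; apply; rewrite /geodesic_velocity -/r; congr (_ + _).
have [/r0 ->|rN0] := eqVneq r 0; first by rewrite !scaler0.
by rewrite scalerA; congr (_ *: _); field.
Qed.

Lemma geodesic_velocity_deriv t :
  is_derive t 1 (geodesic_velocity p v) (r ^+ 2 *: geodesic_curve p v t).
Proof.
have d1 := is_derive_scalel (r *: p) (is_derive_sinhMl r t).
have d2 := is_derive_scalel v (is_derive_coshMl r t).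
have := is_deriveD d1 d2.
rewrite [X in is_derive _ _ X](_ : _ = geodesic_velocity p v); last first.
  by apply/funext => s; rewrite /geodesic_velocity !fctE -/r scalerA (mulrC _ r).
move=> /is_derive_eq; apply; rewrite /geodesic_curve -/r scalerDr !scalerA.
have [/r0 ->|rN0] := eqVneq r 0.
  by rewrite !scaler0 !addr0; congr (_ *: _); ring.
by congr (_ *: _ + _ *: _); field.
Qed.

(** The square is [sinh ^+ 2 - cosh ^+ 2 = -1], and the product with [p] is [- cosh < 0], which
    selects the right sheet. *)
Lemma geodesic_curve_hyperboloid t : hyperboloid (geodesic_curve p v t).
Proof.
have pp : lorentz p p = -1 by have [] := hp.
have pv : lorentz p v = 0 by [].
apply: (future_hyperboloid hp); rewrite /geodesic_curve -/r !lorentzE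
  pp ?(lorentzC v p) pv -?r2.
  have [->|rN0] := eqVneq r 0; first by rewrite mul0r cosh0 expr2; ring.
  have := cosh2_sinh2 (r * t); move: (cosh _) (sinh _) => c s e.
  by field: e.
rewrite mulr0 addr0 mulrN1 oppr_lt0; exact: lt_le_trans (cosh_ge1 _).
Qed.

Lemma geodesic_curve_geodesic : geodesic (geodesic_curve p v).
Proof.
have e1 : derive1 (geodesic_curve p v) = geodesic_velocity p v.
  by apply/funext => t; apply/is_derive_derive1/geodesic_curve_deriv.
split.
- exact: geodesic_curve_hyperboloid.
- by move=> t; have [] := geodesic_curve_deriv t.
- by move=> t; rewrite e1; have [] := geodesic_velocity_deriv t.
- move=> t; rewrite /covariant_derive e1.
  rewrite (is_derive_derive1 (geodesic_velocity_deriv t)) /tangent_proj lorentzZr.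
  have [-> _] := geodesic_curve_hyperboloid t.
  by rewrite mulrN1 scaleNr addrN.
Qed.

Lemma geodesic_curve0 : geodesic_curve p v 0 = p.
Proof.
by rewrite /geodesic_curve mulr0 cosh0 sinh0 mul0r scale0r scale1r addr0.
Qed.

Lemma geodesic_velocity0 : geodesic_velocity p v 0 = v.
Proof.
by rewrite /geodesic_velocity mulr0 cosh0 sinh0 mulr0 scale0r scale1r add0r.
Qed.

End tangent_vector.

(** Differentiating [<g, g'> = 0] gives [<g, g''> = - <g', g'>], so vanishing covariant acceleration
    means [g'' = <g', g'> g]. As [g'] is orthogonal to [g], the coefficient has zero derivative and
    the equation becomes linear. *)
Lemma geodesic_eq g : geodesic g ->
  [/\ hyperboloid (g 0), tangent (g 0) (derive1 g 0) &
      forall t, is_derive t 1 (derive1 g)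
        (lorentz (derive1 g 0) (derive1 g 0) *: g t)].
Proof.
move=> [hg dg ddg cg].
have Dg t := derive1P (dg t); have Dg' t := derive1P (ddg t).
have gg' t : lorentz (g t) (derive1 g t) = 0.
  exact: hyperboloid_velocity.
have gg'' t : lorentz (g t) (derive1 (derive1 g) t) =
    - lorentz (derive1 g t) (derive1 g t).
  have /eqP := is_derive_lorentz_cst (Dg t) (Dg' t) gg'.
  by rewrite addrC addr_eq0 => /eqP.
have g'' t : derive1 (derive1 g) t =
    lorentz (derive1 g t) (derive1 g t) *: g t.
  have := cg t; rewrite /covariant_derive /tangent_proj gg'' scaleNr => /eqP.
  by rewrite subr_eq0 => /eqP.
have speed t : lorentz (derive1 g t) (derive1 g t) =
    lorentz (derive1 g 0) (derive1 g 0).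
  apply: (@is_derive_0_is_cst R (fun t => lorentz (derive1 g t) (derive1 g t))) => s.
  have := is_derive_lorentz (Dg' s) (Dg' s) => /is_derive_eq; apply.
  by rewrite g'' lorentzZl lorentzZr (lorentzC _ (g s)) gg' mulr0 addr0.
split => [//||t]; first by rewrite /tangent /= gg'.
by rewrite -(speed t) -g''.
Qed.

(** Each coordinate of the difference of the two curves solves the linear equation with zero initial
    data. *)
Lemma geodesicP g : geodesic g -> g = geodesic_curve (g 0) (derive1 g 0).
Proof.
move=> Gg; have [hg0 tg0 g''] := geodesic_eq Gg; have [_ dg _ _] := Gg.
set p := g 0 in hg0 tg0 *; set v := derive1 g 0 in tg0 g'' *.
apply/funext => t; apply/matrixP => i j; rewrite (ord1 j) {j}.
apply/eqP; rewrite -subr_eq0; apply/eqP.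
apply: (@ode_exp_unique R (Num.sqrt (lorentz v v))
  (fun t => g t i 0 - geodesic_curve p v t i 0)
  (fun t => derive1 g t i 0 - geodesic_velocity p v t i 0)).
- move=> s; apply: is_deriveB.
    exact: ((is_derive_mxP _ _ _).1 (derive1P (dg s))).
  exact: ((is_derive_mxP _ _ _).1 (geodesic_curve_deriv hg0 tg0 s)).
- move=> s; rewrite mulrBr; apply: is_deriveB.
    have := (is_derive_mxP _ _ _).1 (g'' s) i 0.
    by rewrite mxE sqr_sqrtr // (tangent_lorentz_ge0 hg0).
  have := (is_derive_mxP _ _ _).1 (geodesic_velocity_deriv hg0 tg0 s) i 0.
  by rewrite mxE.
- by rewrite geodesic_curve0 subrr.
- by rewrite geodesic_velocity0 subrr.
Qed.

End curves.

(** * Closed forms of the exponential, the logarithm and parallel transport *)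

Section hyperbolic_maps.
Context {R : realType} {d : nat}.
Implicit Types (p q x v w : 'cV[R]_d.+1) (g V : R -> 'cV[R]_d.+1) (t : R).

Lemma geodesic_curve1 p v : hyperboloid p -> tangent p v ->
  geodesic_curve p v 1 = cosh (Num.sqrt (lorentz v v)) *: p
    + sinhc (Num.sqrt (lorentz v v)) *: v.
Proof.
move=> hp tv; set r := Num.sqrt _; rewrite /geodesic_curve -/r mulr1 /sinhc.
have [r0|//] := eqVneq r 0; rewrite (tangent_lorentz_eq0 hp tv) ?scaler0 //.
by rewrite -(sqr_sqrtr (tangent_lorentz_ge0 hp tv)) -/r r0 expr2 mul0r.
Qed.

Lemma hexpE p v : hyperboloid p -> tangent p v ->
  hexp p v = geodesic_curve p v 1.
Proof.
move=> hp tv; apply: (@get_unique _ _ (geodesic_curve p v 1)) => /=.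
  exists (geodesic_curve p v); split => //.
  - exact: geodesic_curve_geodesic.
  - exact: geodesic_curve0.
  - by rewrite (is_derive_derive1 (geodesic_curve_deriv hp tv 0)) geodesic_velocity0.
by move=> y [g [Gg g0 dg0 <-]]; rewrite (geodesicP Gg) g0 dg0.
Qed.

(** Closed form of the logarithm: the tangential part of [x] at [p], of length [sinh rho], rescaled
    to length [rho], the distance. *)
Definition log_vector p x : 'cV[R]_d.+1 :=
  (sinhc (arcosh (- lorentz p x)))^-1 *: (x + lorentz p x *: p).

Lemma sinhc_neq0 (r : R) : 0 <= r -> sinhc r != 0.
Proof. by move=> r0; rewrite gt_eqF // (lt_le_trans _ (sinhc_ge1 r0)). Qed.

Lemma log_vector_tangent p x : hyperboloid p -> hyperboloid x ->
  tangent p (log_vector p x).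
Proof.
move=> hp hx; have [tz _] := lorentz_projection hp hx.
by rewrite /tangent /= lorentzZr tz mulr0.
Qed.

Lemma log_vector_norm p x : hyperboloid p -> hyperboloid x ->
  Num.sqrt (lorentz (log_vector p x) (log_vector p x)) = arcosh (- lorentz p x).
Proof.
move=> hp hx; have [_ zz] := lorentz_projection hp hx.
have a1 := lorentz_hyperboloid_le hp hx; have rho0 := arcosh_ge0 a1.
rewrite /log_vector; set rho := arcosh _ in rho0 *.
rewrite lorentzZl lorentzZr zz.
have -> : lorentz p x ^+ 2 - 1 = (sinhc rho * rho) ^+ 2.
  by rewrite sinhcM -sqrrN -{1}(cosh_arcosh a1) cosh2_sinh2 -/rho; ring.
rewrite (_ : _ * _ = rho ^+ 2); last by field; rewrite sinhc_neq0.
by rewrite sqrtr_sqr ger0_norm.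
Qed.

Lemma geodesic_log_vector p x : hyperboloid p -> hyperboloid x ->
  geodesic_curve p (log_vector p x) 1 = x.
Proof.
move=> hp hx; have a1 := lorentz_hyperboloid_le hp hx.
rewrite geodesic_curve1 ?log_vector_norm //; last exact: log_vector_tangent.
rewrite cosh_arcosh // /log_vector scalerA divff ?sinhc_neq0 ?arcosh_ge0 //.
by rewrite scale1r scaleNr addrC addrK.
Qed.

(** If [v] is sent to [x], pairing with [p] gives [- lorentz p x = cosh r] with [r] the length of
    [v]; so [arcosh] recovers [r], and subtracting the component along [p] recovers [v]. *)
Lemma hlogE p x : hyperboloid p -> hyperboloid x -> hlog p x = log_vector p x.
Proof.
move=> hp hx; have pp : lorentz p p = -1 by have [] := hp.
have tl := log_vector_tangent hp hx.
apply: get_unique => /=.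
  by split => //; rewrite hexpE // geodesic_log_vector.
move=> v [tv]; rewrite hexpE // geodesic_curve1 // => xE.
set r := Num.sqrt _ in xE.
have px : - lorentz p x = cosh r.
  by rewrite -xE !lorentzE pp tv mulr0 addr0 mulrN1 opprK.
rewrite /log_vector px coshK ?sqrtr_ge0 // -[lorentz p x]opprK px scaleNr -xE.
by rewrite [cosh r *: p + _]addrC addrK scalerA mulVf ?scale1r // sinhc_neq0 ?sqrtr_ge0.
Qed.

Section along_geodesic.
Context p v (hp : hyperboloid p) (tv : tangent p v).
Let r := Num.sqrt (lorentz v v).

Let r2 : r ^+ 2 = lorentz v v.
Proof. by rewrite sqr_sqrtr // (tangent_lorentz_ge0 hp). Qed.

Let r0 : r = 0 -> v = 0.
Proof.
by move=> r0; apply: (tangent_lorentz_eq0 hp tv); rewrite -r2 r0 expr2 mul0r.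
Qed.

Let pp : lorentz p p = -1. Proof. by have [] := hp. Qed.

(** The quotient defining [transport] is turned into an expression affine in [sinh (r * t)] and
    [cosh (r * t)], which can be differentiated termwise. *)
Lemma transport_geodesicE w t : tangent p w ->
  transport p (geodesic_curve p v t) w =
  w + lorentz v w *: ((sinh (r * t) / r) *: p + ((cosh (r * t) - 1) / r ^+ 2) *: v).
Proof.
move=> tw; rewrite /transport /geodesic_curve -/r !lorentzE pp tv tw.
have [/r0 ->|rN0] := eqVneq r 0.
  by rewrite (lorentzC 0) lorentz0r !mulr0 add0r mul0r !scale0r.
congr (_ + _); rewrite addrA -{1}(scale1r p) -scalerDl !scalerDr !scalerA.
have := cosh2_sinh2 (r * t).
have : cosh (r * t) + 1 != 0.
  by rewrite gt_eqF // addr_gt0 // (lt_le_trans _ (cosh_ge1 _)).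
move: (cosh _) (sinh _) => c s c0 cs.
have e : 1 - (c * -1 + s / r * 0) = c + 1 by ring.
rewrite e mulr0 add0r; congr (_ *: _ + _ *: _).
  by field; rewrite c0 rN0.
have -> : c - 1 = s ^+ 2 / (c + 1).
  by apply/(canRL (mulfK c0)); rewrite -[s ^+ 2](addKr 1) -cs; ring.
by field; rewrite c0 rN0.
Qed.

(** The derivative is along the position vector, hence normal to the hyperboloid: this is what makes
    the field parallel. *)
Lemma transport_geodesic_deriv w t : tangent p w ->
  is_derive t 1 (fun t => transport p (geodesic_curve p v t) w)
    (lorentz v w *: geodesic_curve p v t).
Proof.
move=> tw.
have d1 := is_derive_scalel ((lorentz v w / r) *: p) (is_derive_sinhMl r t).
have d2 := is_derive_scalel ((lorentz v w / r ^+ 2) *: v) (is_derive_coshMl r t).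
have := is_deriveD (is_derive_cst (w - (lorentz v w / r ^+ 2) *: v) t 1) (is_deriveD d1 d2).
rewrite [X in is_derive _ _ X](_ : _ =
    (fun t => transport p (geodesic_curve p v t) w)); last first.
  apply/funext => s; rewrite transport_geodesicE // !fctE scalerDr -addrA; congr (_ + _).
  rewrite !scalerA addrCA; congr (_ + _).
    by congr (_ *: _); rewrite mulrCA.
  by rewrite addrC -scalerBl; congr (_ *: _); ring.
move=> /is_derive_eq; apply; rewrite add0r /geodesic_curve -/r scalerDr !scalerA.
have [/r0 ->|rN0] := eqVneq r 0.
  by rewrite (lorentzC 0) lorentz0r !(mul0r, mulr0, scale0r).
by congr (_ *: _ + _ *: _); field.
Qed.

Lemma transport_parallel w : tangent p w ->
  parallel_along (geodesic_curve p v) (fun t => transport p (geodesic_curve p v t) w).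
Proof.
move=> tw; split.
- by move=> t; apply: transport_tangent => //; exact: geodesic_curve_hyperboloid.
- by move=> t; have [] := transport_geodesic_deriv t tw.
move=> t; rewrite /covariant_derive (is_derive_derive1 (transport_geodesic_deriv t tw)).
rewrite /tangent_proj lorentzZr; have [-> _] := geodesic_curve_hyperboloid hp tv t.
by rewrite mulrN1 scaleNr addrN.
Qed.

(** Parallelism reads [V' = <g', V> g]. The coefficient is conserved, because [g''] is along [g],
    orthogonal to [V], and [V'] is along [g], orthogonal to [g']. So [V] and the closed form have
    the same derivative and the same initial value. *)
Lemma parallelP V : parallel_along (geodesic_curve p v) V ->
  V = fun t => transport p (geodesic_curve p v t) (V 0).
Proof.
set g := geodesic_curve p v => -[tV dV cV].
have DV t := derive1P (dV t).
have Dg t : is_derive t 1 g (geodesic_velocity p v t) by exact: geodesic_curve_deriv.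
have Dg' t : is_derive t 1 (geodesic_velocity p v) (r ^+ 2 *: g t).
  exact: geodesic_velocity_deriv.
have hg t : hyperboloid (g t) by exact: geodesic_curve_hyperboloid.
have gg' t : lorentz (g t) (geodesic_velocity p v t) = 0.
  exact: hyperboloid_velocity.
have gV' t : lorentz (g t) (derive1 V t) = - lorentz (geodesic_velocity p v t) (V t).
  have /eqP := is_derive_lorentz_cst (Dg t) (DV t) tV.
  by rewrite addrC addr_eq0 => /eqP.
have V' t : derive1 V t = lorentz (geodesic_velocity p v t) (V t) *: g t.
  have := cV t; rewrite /covariant_derive /tangent_proj gV' scaleNr => /eqP.
  by rewrite subr_eq0 => /eqP.
have g0 : g 0 = p by exact: geodesic_curve0.
have tV0 : tangent p (V 0) by rewrite -g0.
have k t : lorentz (geodesic_velocity p v t) (V t) = lorentz v (V 0).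
  rewrite -{2}(geodesic_velocity0 p v).
  apply: (@is_derive_0_is_cst R (fun t => lorentz (geodesic_velocity p v t) (V t))) => s.
  have := is_derive_lorentz (Dg' s) (DV s) => /is_derive_eq; apply.
  by rewrite V' lorentzZl lorentzZr (lorentzC _ (g s)) gg' (tV s) !mulr0 addr0.
have e0 : transport p (g 0) (V 0) = V 0.
  by rewrite g0 /transport tV0 mul0r scale0r addr0.
apply/funext => t; apply/matrixP => i j; rewrite (ord1 j) {j}.
suff : V t i 0 - transport p (g t) (V 0) i 0 =
    V 0 i 0 - transport p (g 0) (V 0) i 0.
  by rewrite e0 subrr => /eqP; rewrite subr_eq0 => /eqP.
apply: (@is_derive_0_is_cst R (fun t => V t i 0 - transport p (g t) (V 0) i 0)) => s.
have := is_deriveB ((is_derive_mxP _ _ _).1 (DV s) i 0)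
  ((is_derive_mxP _ _ _).1 (transport_geodesic_deriv s tV0) i 0).
by move=> /is_derive_eq; apply; rewrite V' k subrr.
Qed.

End along_geodesic.

(** Along any geodesic issued from [p], the final value of the parallel field is the closed form at
    the endpoint [q], so the value selected by [get] is determined. *)
Lemma ptransportE p q w : hyperboloid p -> hyperboloid q -> tangent p w ->
  ptransport p q w = transport p q w.
Proof.
move=> hp hq tw; have tv := log_vector_tangent hp hq; have <- := geodesic_log_vector hp hq.
set v := log_vector p q in tv *.
apply: get_unique => /=.
  exists (geodesic_curve p v), (fun t => transport p (geodesic_curve p v t) w).
  split; split => //.
  - exact: geodesic_curve_geodesic.
  - exact: geodesic_curve0.
  - exact: transport_parallel.
  - by rewrite geodesic_curve0 /transport tw mul0r scale0r addr0.
move=> u [g [V [[Gg g0 g1] [PV V0 <-]]]].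
have [hg0 tg0 _] := geodesic_eq Gg; rewrite (geodesicP Gg) in PV g1.
by rewrite (parallelP hg0 tg0 PV) V0 g1 g0.
Qed.

Definition chart mu x : 'cV[R]_d :=
  spatial (transport mu origin (log_vector mu x)).

(** Transport from [mu] back to the origin inverts transport from the origin to [mu], on tangent
    vectors. *)
Lemma tangent_coordE mu x : hyperboloid mu -> hyperboloid x ->
  tangent_coord mu x = chart mu x.
Proof.
move=> hmu hx; have ho := @origin_hyperboloid R d.
have tz := log_vector_tangent hmu hx.
have tz' := transport_tangent hmu ho tz.
apply: get_unique => /=.
  by rewrite spatialK // hlogE // ptransportE // transportK.
move=> v; rewrite hlogE // ptransportE //; last exact: tangent_at_originP.
rewrite /chart => <-; rewrite transportK ?tangent_at_originK //.
exact: tangent_at_originP.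
Qed.

Lemma euclid_norm_chart mu x : hyperboloid mu -> hyperboloid x ->
  euclid_norm (chart mu x) = arcosh (- lorentz mu x).
Proof.
move=> hmu hx; have ho := @origin_hyperboloid R d.
have tz := log_vector_tangent hmu hx.
rewrite euclid_normE ?transport_isometry ?log_vector_norm //.
exact: transport_tangent.
Qed.

End hyperbolic_maps.

(* At negative x too, because ln vanishes there. *)
Lemma continuous_ln_neq0 {R : realType} (x : R) : x != 0 ->
  continuous_at x (@ln R).
Proof.
rewrite neq_lt => /orP[x0|]; last exact: continuous_ln.
rewrite /continuous_at (ln0 (ltW x0)); apply: cvg_near_cst.
have : \forall y \near x, y < 0.
  by apply: (@open_nbhs_nbhs R _ [set x | x < 0]); split => //; exact: open_lt.
by apply: filterS => y y0; rewrite ln0 // ltW.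
Qed.

(** * Continuity of matrix operations and of the chart *)

Section matrix_limits.
Context {R : realType} {I : topologicalType} (i0 : I).

Lemma eq_continuous_at (U : topologicalType) (f g : I -> U) :
  f =1 g -> continuous_at i0 g -> continuous_at i0 f.
Proof. by move=> /funext ->. Qed.

Section scalar.
Implicit Types f g : I -> R.

Lemma continuous_atD f g : continuous_at i0 f -> continuous_at i0 g ->
  continuous_at i0 (fun t => f t + g t).
Proof. exact: cvgD. Qed.

Lemma continuous_atN f : continuous_at i0 f -> continuous_at i0 (fun t => - f t).
Proof. exact: cvgN. Qed.

Lemma continuous_atM f g : continuous_at i0 f -> continuous_at i0 g ->
  continuous_at i0 (fun t => f t * g t).
Proof. exact: cvgM. Qed.

Lemma continuous_atV f : f i0 != 0 -> continuous_at i0 f ->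
  continuous_at i0 (fun t => (f t)^-1).
Proof. exact: cvgV. Qed.

End scalar.

Lemma continuous_at_cst (U : topologicalType) (a : U) :
  continuous_at i0 (fun=> a).
Proof. exact: cvg_cst. Qed.

Lemma continuous_at_comp (U V : topologicalType) (f : I -> U) (g : U -> V) :
  continuous_at i0 f -> continuous_at (f i0) g -> continuous_at i0 (fun t => g (f t)).
Proof. exact: cvg_comp. Qed.

Lemma continuous_mxP m n (M : I -> 'M[R]_(m, n)) :
  continuous_at i0 M <-> forall i j, continuous_at i0 (fun t => M t i j).
Proof.
split=> [cM i j|cM].
  exact: (continuous_at_comp cM (@coord_continuous _ _ _ _ _ _)).
move=> A [P MP PA].
have : \forall t \near i0, forall i j, P i j (M t i j).
  apply: filter_forall => i; apply: filter_forall => j.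
  exact: (cM i j _ (MP i j)).
by apply: filterS => t Pt; apply: PA.
Qed.

Lemma continuous_sum (J : finType) (P : pred J) (f : J -> I -> R) :
  (forall j, P j -> continuous_at i0 (f j)) ->
  continuous_at i0 (fun t => \sum_(j | P j) f j t).
Proof.
move=> cf; apply: cvg_big => //; move=> x.
by apply: cvgD; [exact: cvg_fst|exact: cvg_snd].
Qed.

Lemma continuous_prod (J : finType) (P : pred J) (f : J -> I -> R) :
  (forall j, P j -> continuous_at i0 (f j)) ->
  continuous_at i0 (fun t => \prod_(j | P j) f j t).
Proof.
move=> cf; apply: cvg_big => //; move=> x.
by apply: cvgM; [exact: cvg_fst|exact: cvg_snd].
Qed.

Lemma continuous_addmx m n (M N : I -> 'M[R]_(m, n)) :
  continuous_at i0 M -> continuous_at i0 N ->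
  continuous_at i0 (fun t => M t + N t).
Proof. by move=> cM cN; exact: cvgD. Qed.

Lemma continuous_scalemx m n (a : I -> R) (M : I -> 'M[R]_(m, n)) :
  continuous_at i0 a -> continuous_at i0 M ->
  continuous_at i0 (fun t => a t *: M t).
Proof. by move=> ca cM; exact: cvgZ. Qed.

Lemma continuous_mulmx m n p (M : I -> 'M[R]_(m, n)) (N : I -> 'M[R]_(n, p)) :
  continuous_at i0 M -> continuous_at i0 N ->
  continuous_at i0 (fun t => M t *m N t).
Proof.
move=> /continuous_mxP cM /continuous_mxP cN; apply/continuous_mxP => i j.
apply: eq_continuous_at => [t|]; first by rewrite mxE.
by apply: continuous_sum => k _; apply: continuous_atM.
Qed.

Lemma continuous_trmx m n (M : I -> 'M[R]_(m, n)) :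
  continuous_at i0 M -> continuous_at i0 (fun t => (M t)^T).
Proof.
move=> /continuous_mxP cM; apply/continuous_mxP => i j.
by apply: eq_continuous_at => [t|]; first by rewrite mxE.
Qed.

Lemma continuous_det n (M : I -> 'M[R]_n) :
  continuous_at i0 M -> continuous_at i0 (fun t => \det (M t)).
Proof.
move=> /continuous_mxP cM; apply: continuous_sum => s _.
apply: continuous_atM; first exact: continuous_at_cst.
by apply: continuous_prod => i _.
Qed.

Lemma continuous_invmx n (M : I -> 'M[R]_n) : \det (M i0) != 0 ->
  continuous_at i0 M -> continuous_at i0 (fun t => invmx (M t)).
Proof.
move=> dM cM.
have cadj : continuous_at i0 (fun t => (\det (M t))^-1 *: \adj (M t)).
  apply/continuous_mxP => i j; apply: eq_continuous_at => [t|]; first by rewrite !mxE.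
  have cdet := continuous_det cM.
  apply: continuous_atM; first exact: continuous_atV.
  apply: continuous_atM; first exact: continuous_at_cst.
  apply: continuous_det; apply/continuous_mxP => k l.
  apply: eq_continuous_at => [t|]; first by rewrite !mxE.
  by move/continuous_mxP : cM; exact.
move: cadj; rewrite /continuous_at /= {2}/invmx unitmxE unitfE dM.
apply: cvg_trans; apply: near_eq_cvg.
(* [invmx] is given by the adjugate formula only at invertible matrices, and [M t] is invertible for
   [t] near [i0]. *)
have ne0 : nbhs (\det (M i0)) [set x | x != 0].
  by apply: (@open_nbhs_nbhs R _ [set x | x != 0]); split => //; exact: open_neq.
have : nbhs i0 [set t | \det (M t) != 0] := continuous_det cM ne0.
by apply: filterS => t dt; rewrite /invmx unitmxE unitfE dt.
Qed.

Lemma continuous_quad_form n (M : I -> 'M[R]_n) (v : I -> 'cV[R]_n) :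
  continuous_at i0 M -> continuous_at i0 v ->
  continuous_at i0 (fun t => quad_form (M t) (v t)).
Proof.
move=> cM cv; have cvT := continuous_trmx cv.
by have /continuous_mxP := continuous_mulmx (continuous_mulmx cvT cM) cv; exact.
Qed.

Lemma continuous_ln_det n (M : I -> 'M[R]_n) : \det (M i0) != 0 ->
  continuous_at i0 M -> continuous_at i0 (fun t => ln (\det (M t))).
Proof.
move=> dM cM; apply: (continuous_at_comp (continuous_det cM)).
exact: continuous_ln_neq0.
Qed.

Section chart_continuity.
Context {d : nat}.
Implicit Types p q x : I -> 'cV[R]_d.+1.

Lemma continuous_lorentz p q :
  continuous_at i0 p -> continuous_at i0 q ->
  continuous_at i0 (fun t => lorentz (p t) (q t)).
Proof.
move=> /continuous_mxP cp /continuous_mxP cq; apply: continuous_atD.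
  by apply: continuous_atN; apply: continuous_atM.
by apply: continuous_sum => j _; apply: continuous_atM.
Qed.

Lemma continuous_arcosh_lorentz p x : hyperboloid (p i0) -> hyperboloid (x i0) ->
  continuous_at i0 p -> continuous_at i0 x ->
  continuous_at i0 (fun t => arcosh (- lorentz (p t) (x t))).
Proof.
move=> hp hx cp cx.
have cl := continuous_atN (continuous_lorentz cp cx).
apply: (continuous_at_comp cl); apply: arcosh_continuous.
by rewrite oppr_gt0 lorentz_hyperboloid_lt0.
Qed.

Lemma continuous_chart p x : hyperboloid (p i0) -> hyperboloid (x i0) ->
  continuous_at i0 p -> continuous_at i0 x ->
  continuous_at i0 (fun t => chart (p t) (x t)).
Proof.
move=> hp hx cp cx.
have cl := continuous_lorentz cp cx.
have ca := continuous_arcosh_lorentz hp hx cp cx.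
have cs := continuous_at_comp ca (@sinhc_continuous R _).
have cw : continuous_at i0 (fun t => log_vector (p t) (x t)).
  apply: continuous_scalemx.
    apply: continuous_atV => //; apply: sinhc_neq0; apply: arcosh_ge0.
    exact: lorentz_hyperboloid_le.
  exact: (continuous_addmx cx (continuous_scalemx cl cp)).
have co : continuous_at i0 (fun=> origin : 'cV[R]_d.+1) by exact: continuous_at_cst.
have ct : continuous_at i0 (fun t => transport (p t) origin (log_vector (p t) (x t))).
  apply: (continuous_addmx cw); apply: continuous_scalemx; last first.
    exact: (continuous_addmx cp co).
  apply: continuous_atM; first exact: continuous_lorentz.
  apply: continuous_atV; first exact: transport_denom (@origin_hyperboloid _ _).
  apply: continuous_atD; first exact: continuous_at_cst.
  by apply: continuous_atN; exact: continuous_lorentz.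
apply/continuous_mxP => i j; apply: eq_continuous_at => [t|]; first by rewrite mxE.
by move/continuous_mxP : ct; exact.
Qed.

End chart_continuity.

End matrix_limits.

(** * Compact boxes of matrices *)

Section matrix_compactness.
Context {R : realType}.

Lemma closed_ge0 (T : topologicalType) (h : T -> R) :
  continuous h -> closed [set x | 0 <= h x].
Proof.
move=> ch; rewrite -[X in closed X]setTI; apply: closed_ge0_in; first exact: closedT.
by move=> x _; exact: ch.
Qed.

Definition mx_box m n (B : R) : set 'M[R]_(m, n) :=
  [set M | forall i j, `|M i j| <= B].

Lemma mx_box_closed m n B : closed (@mx_box m n B).
Proof.
rewrite (_ : mx_box _ = \bigcap_i \bigcap_j [set M | 0 <= B - `|M i j|]); last first.
  by apply/seteqP; split=> M MB => [i _ j _|i j] /=;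
    [rewrite subr_ge0|rewrite -subr_ge0; exact: (MB i I j I)].
apply: closed_bigI => i _; apply: closed_bigI => j _; apply: closed_ge0 => M.
apply: continuous_atD; first exact: continuous_at_cst.
apply: continuous_atN; apply: (continuous_at_comp (@coord_continuous _ _ _ i j M)).
exact: norm_continuous.
Qed.

Lemma mx_box_compact m n B : compact (@mx_box m n B).
Proof.
(* Flattening to row vectors turns the box into a product of segments. *)
rewrite (_ : mx_box _ = vec_mx @` [set v : 'rV[R]_(m * n) |
    forall k, `[- B, B]%classic (v ord0 k)]); last first.
  apply/seteqP; split=> [M MB|_ [v vB <-] i j].
    exists (mxvec M); last exact: mxvecK.
    move=> k; case/mxvec_indexP: k => i j.
    by rewrite mxvecE /= in_itv /= -ler_norml.
  by rewrite mxE; have := vB (mxvec_index i j); rewrite /= in_itv /= -ler_norml.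
apply: continuous_compact.
  apply: continuous_subspaceT => v; apply/continuous_mxP => i j.
  apply: eq_continuous_at => [t|]; first by rewrite mxE.
  exact: coord_continuous.
by apply: (@rV_compact R _ (fun=> `[- B, B]%classic)) => _; exact: segment_compact.
Qed.

Lemma mx_box_exhaust m n (M : 'M[R]_(m, n)) : exists N : nat, mx_box N.+1%:R M.
Proof.
exists (Num.trunc `|M|) => i j.
apply: (@le_trans _ _ `|M|).
  rewrite [leRHS]/Num.norm /= mx_normrE.
  exact: (le_bigmax _ (fun ij => `|M ij.1 ij.2|) (i, j)).
by rewrite ltW // truncnS_gt.
Qed.

End matrix_compactness.

(** * The covariance shell: compactness and bounds on the inverse *)

Section shell.
Context {R : realType} {d : nat}.
Implicit Types (A B : 'M[R]_d) (u v : 'cV[R]_d).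

Definition sqnorm v : R := \sum_(j < d) v j 0 ^+ 2.

Lemma sqnorm_ge0 v : 0 <= sqnorm v.
Proof. by apply: sumr_ge0 => j _; exact: sqr_ge0. Qed.

Lemma sqnorm_gt0 v : v != 0 -> 0 < sqnorm v.
Proof.
move=> v0; rewrite lt_def sqnorm_ge0 andbT; apply: contraNneq v0 => v0.
apply/eqP/matrixP => i j; rewrite ord1 mxE; apply/eqP.
rewrite -sqrf_eq0; move/eqP: v0; rewrite psumr_eq0 => [/allP/(_ i)|k _].
  by apply; exact: mem_index_enum.
exact: sqr_ge0.
Qed.

Lemma sqnormE v : (v^T *m v) 0 0 = sqnorm v.
Proof. by rewrite mxE; apply: eq_bigr => j _; rewrite mxE expr2. Qed.

Lemma quad_formB A B v : quad_form (B - A) v = quad_form B v - quad_form A v.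
Proof. by rewrite /quad_form mulmxBr mulmxBl !mxE. Qed.

Lemma quad_form_scalar a v : quad_form a%:M v = a * sqnorm v.
Proof. by rewrite /quad_form mul_mx_scalar -scalemxAl mxE sqnormE. Qed.

Lemma quad_formDZ A u s v : quad_form A (u + s *: v) = quad_form A u
  + s * (u^T *m A *m v) 0 0 + s * (v^T *m A *m u) 0 0 + s ^+ 2 * quad_form A v.
Proof.
rewrite /quad_form.
have -> : (u + s *: v)^T = u^T + s *: v^T by apply/matrixP => i j; rewrite !mxE.
rewrite !mulmxDl !mulmxDr -!scalemxAr -!scalemxAl.
set a := u^T *m A *m u; set b := u^T *m A *m v; set c := v^T *m A *m u.
by set e := v^T *m A *m v; rewrite !mxE; ring.
Qed.

Context {lmin lmax : R} (hlmin : 0 < lmin) (hlmax : lmin < lmax).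

Lemma shellP A : shell lmin lmax A <->
  A^T = A /\ forall v, lmin * sqnorm v <= quad_form A v <= lmax * sqnorm v.
Proof.
split=> [[[At _] [_ lA] [_ Au]]|[At Ab]].
  split=> // v; have := lA v; have := Au v.
  by rewrite !quad_formB !quad_form_scalar !subr_ge0 => -> ->.
have sc a : (a%:M : 'M[R]_d)^T = a%:M by rewrite tr_scalar_mx.
split.
- split=> // v v0; have /andP[+ _] := Ab v; apply: lt_le_trans.
  by rewrite mulr_gt0 ?sqnorm_gt0.
- split=> [|v]; first by rewrite linearB /= At sc.
  by rewrite quad_formB quad_form_scalar subr_ge0; case/andP: (Ab v).
- split=> [|v]; first by rewrite linearB /= At sc.
  by rewrite quad_formB quad_form_scalar subr_ge0; case/andP: (Ab v).
Qed.

Lemma shell_scalar : shell lmin lmax (lmin%:M : 'M[R]_d).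
Proof.
apply/shellP; split=> [|v]; first by rewrite tr_scalar_mx.
by rewrite quad_form_scalar lexx /= ler_wpM2r ?sqnorm_ge0 // ltW.
Qed.

Lemma shell_det A : shell lmin lmax A -> \det A != 0.
Proof.
move=> [[_ Apos] _ _]; apply/det0P => -[v v0 vA].
have /Apos : v^T != 0 by apply: contra_neq v0 => /(congr1 trmx); rewrite trmxK linear0.
by rewrite /quad_form trmxK vA mul0mx mxE ltxx.
Qed.

Lemma shell_closed : closed (shell lmin lmax : set 'M[R]_d).
Proof.
have cq v : continuous (fun A : 'M[R]_d => quad_form A v).
  by move=> A; apply: (@continuous_quad_form R _ A _ id (fun=> v));
    [exact: cvg_id|exact: continuous_at_cst].
rewrite (_ : shell _ _ =
  (\bigcap_i \bigcap_j [set A : 'M[R]_d | 0 <= A i j - A j i]) `&`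
  \bigcap_v ([set A | 0 <= quad_form A v - lmin * sqnorm v] `&`
             [set A | 0 <= lmax * sqnorm v - quad_form A v])).
  apply: closedI; apply: closed_bigI => i _.
    apply: closed_bigI => j _; apply: closed_ge0 => A.
    by apply: continuousB; exact: coord_continuous.
  apply: closedI; apply: closed_ge0 => A.
    by apply: continuous_atD; [exact: cq|exact: continuous_at_cst].
  by apply: continuous_atD; [exact: continuous_at_cst|apply: continuous_atN; exact: cq].
apply/seteqP; split=> A.
  move=> /shellP[At Ab]; split=> [i _ j _|v _] /=.
    by rewrite -{2}At mxE subrr.
  by rewrite !subr_ge0; split; case/andP: (Ab v).
move=> [As Av]; apply/shellP; split=> [|v].
  apply/matrixP => i j; rewrite mxE; apply/eqP; rewrite eq_le.
  have := As i I j I; have := As j I i I; rewrite /= !subr_ge0.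
  by move=> -> ->.
by have /= [] := Av v I; rewrite !subr_ge0 => -> ->.
Qed.

(** Basis vectors bound the diagonal entries by [lmax]; positivity on [e_i + e_j] and [e_i - e_j]
    bounds the entry [A i j] by the mean of two diagonal ones. *)
Lemma shell_entry A : shell lmin lmax A -> mx_box lmax A.
Proof.
move=> /shellP[At Ab] i j.
have e_ (k l : 'I_d) :
    ((delta_mx k 0 : 'cV[R]_d)^T *m A *m (delta_mx l 0 : 'cV[R]_d)) 0 0 = A k l.
  by rewrite trmx_delta -mulmxA -colE -rowE !mxE.
have lmax0 : 0 < lmax by exact: lt_trans hlmax.
have diag k : A k k <= lmax.
  have /andP[_] := Ab (delta_mx k 0); rewrite /quad_form e_ => /le_trans; apply.
  rewrite ler_piMr ?(ltW lmax0) // /sqnorm (bigD1 k) //= big1.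
    by rewrite mxE !eqxx expr1n addr0.
  by move=> l lk; rewrite mxE (negbTE lk) expr0n.
have off s : 0 <= A i i + s * A i j + s * A j i + s ^+ 2 * A j j.
  have /andP[+ _] := Ab (delta_mx i 0 + s *: delta_mx j 0).
  rewrite quad_formDZ /quad_form !e_ => /(le_trans _); apply.
  by rewrite mulr_ge0 ?sqnorm_ge0 // ltW.
have sym : A j i = A i j by rewrite -{1}At mxE.
have := off 1; have := off (-1); have := diag i; have := diag j.
rewrite sym sqrrN expr1n ler_norml => *; apply/andP; split; lra.
Qed.

Lemma shell_compact : compact (shell lmin lmax : set 'M[R]_d).
Proof.
apply: subclosed_compact shell_closed (@mx_box_compact R d d lmax) _.
exact: shell_entry.
Qed.

(* 0 <= (w - v / lmax)^T A (w - v / lmax) with w = A^-1 v. *)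
Lemma quad_form_invmx_ge A v : shell lmin lmax A ->
  sqnorm v / lmax <= quad_form (invmx A) v.
Proof.
move=> sA; have uA : A \in unitmx by rewrite unitmxE unitfE shell_det.
have /shellP[At Ab] := sA.
have lmax0 : 0 < lmax by exact: lt_trans hlmax.
set w := invmx A *m v; have Aw : A *m w = v by rewrite mulKVmx.
have wA : w^T *m A = v^T by rewrite -{1}At -trmx_mul Aw.
have /andP[+ _] := Ab (w + (- lmax^-1) *: v).
rewrite quad_formDZ {1}/quad_form wA -(mulmxA v^T A w) Aw sqnormE sqrrN.
have -> : (v^T *m w) 0 0 = quad_form (invmx A) v by rewrite /quad_form -mulmxA.
have : 0 <= lmin * sqnorm (w + (- lmax^-1) *: v).
  by rewrite mulr_ge0 ?sqnorm_ge0 // ltW.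
move=> h0 /(le_trans h0){h0}.
have /andP[_ h2] := Ab v.
(* The expansion is the inverse form at [v], minus twice [sqnorm v / lmax], plus this quadratic
   term, which gives back at most one of the two copies. *)
have : lmax^-1 ^+ 2 * quad_form A v <= sqnorm v / lmax.
  apply: le_trans (ler_wpM2l (sqr_ge0 _) h2) _.
  by rewrite le_eqVlt; apply/orP; left; apply/eqP; field; rewrite gt_eqF.
rewrite mulNr (mulrC _ (sqnorm v)).
move: (sqnorm v / lmax) (quad_form _ _) (_ * quad_form _ _) => a b c; lra.
Qed.

End shell.

(** * The log-likelihood: continuity, upper bound, coercivity *)

Section likelihood.
Context {R : realType} {d n : nat}.
Implicit Types (mu x : 'cV[R]_d.+1) (Sigma : 'M[R]_d) (X : 'M[R]_(d.+1, n)).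

Lemma log_sinhcE (v : 'cV[R]_d) : log_sinhc v = ln (sinhc (euclid_norm v)).
Proof.
rewrite /log_sinhc; have [->|v0] := eqVneq v 0.
  rewrite /euclid_norm big1 ?sqrtr0 ?/sinhc ?eqxx ?ln1 // => j _.
  by rewrite mxE expr0n.
rewrite /sinhc; suff /negbTE -> : euclid_norm v != 0 by [].
by rewrite gt_eqF // sqrtr_gt0 sqnorm_gt0.
Qed.

(* Unlike log_density, whose tangent coordinates are junk off the hyperboloid,
   these functions are continuous at the points of the hyperboloid as functions
   on the ambient space. *)
Definition chart_log_density mu Sigma x : R :=
  - 2^-1 * ln (\det Sigma) - 2^-1 * quad_form (invmx Sigma) (chart mu x)
  - (d%:R - 1) * ln (sinhc (arcosh (- lorentz mu x))).

Definition chart_loglik X mu Sigma : R :=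
  \sum_(i < n) chart_log_density mu Sigma (col i X).

Lemma loglikE X mu Sigma : sample_space X -> hyperboloid mu ->
  loglik X mu Sigma = chart_loglik X mu Sigma.
Proof.
move=> SX hmu; apply: eq_bigr => i _.
by rewrite /log_density tangent_coordE // log_sinhcE euclid_norm_chart.
Qed.

(** The trace of [v *m v^T] times the inverse covariance is the quadratic form at [v]. The remaining
    term depends on [mu] only, so at fixed [mu] minimizing the objective is maximizing the
    likelihood. *)
Lemma loglik_cov_objective X mu Sigma : (0 < n)%N ->
  loglik X mu Sigma = - (n%:R / 2) * cov_objective X mu Sigma
    - (d%:R - 1) * \sum_(i < n) log_sinhc (tangent_coord mu (col i X)).
Proof.
move=> n0; have nN0 : n%:R != 0 :> R by rewrite pnatr_eq0 -lt0n.
rewrite /cov_objective.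
have -> : \tr (scatter X mu *m invmx Sigma) =
    n%:R^-1 * \sum_(i < n) quad_form (invmx Sigma) (tangent_coord mu (col i X)).
  rewrite /scatter -scalemxAl linearZ /= mulmx_suml linear_sum /=; congr (_ * _).
  by apply: eq_bigr => i _; rewrite -mulmxA mxtrace_mulC /quad_form trace_mx11.
rewrite /loglik /log_density !big_split /= !sumrN -!mulr_sumr sumr_const card_ord.
by rewrite -mulr_natl; field.
Qed.

Lemma cov_objective_le X mu Sigma Sigma' : (0 < n)%N ->
  (cov_objective X mu Sigma <= cov_objective X mu Sigma') =
  (loglik X mu Sigma' <= loglik X mu Sigma).
Proof.
move=> n0; rewrite !loglik_cov_objective // lerD2r !mulNr lerN2 ler_pM2l //.
by rewrite divr_gt0 // ltr0n.
Qed.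

Lemma continuous_chart_loglik (I : topologicalType) (i0 : I)
    (X : I -> 'M[R]_(d.+1, n)) (mu : I -> 'cV[R]_d.+1) (Sigma : I -> 'M[R]_d) :
  sample_space (X i0) -> hyperboloid (mu i0) -> \det (Sigma i0) != 0 ->
  continuous_at i0 X -> continuous_at i0 mu -> continuous_at i0 Sigma ->
  continuous_at i0 (fun t => chart_loglik (X t) (mu t) (Sigma t)).
Proof.
move=> SX hmu dS cX cmu cS; apply: continuous_sum => i _.
have cx : continuous_at i0 (fun t => col i (X t)).
  apply/continuous_mxP => k l; apply: eq_continuous_at => [t|]; first by rewrite mxE.
  by move/continuous_mxP : cX; exact.
have ca := @continuous_arcosh_lorentz _ _ i0 _ mu _ hmu (SX i) cmu cx.
have cch := @continuous_chart _ _ i0 _ mu _ hmu (SX i) cmu cx.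
have s1 : 1 <= sinhc (arcosh (- lorentz (mu i0) (col i (X i0)))).
  by apply: sinhc_ge1; apply: arcosh_ge0; exact: lorentz_hyperboloid_le (SX i).
have cst (a : R) := @continuous_at_cst I i0 R a.
apply: continuous_atD; last first.
  apply: continuous_atN; apply: (continuous_atM (cst _)).
  apply: (continuous_at_comp (continuous_at_comp ca (@sinhc_continuous R _))).
  by apply: continuous_ln; exact: lt_le_trans s1.
apply: continuous_atD; first by apply: (continuous_atM (cst _)); exact: continuous_ln_det.
apply: continuous_atN; apply: (continuous_atM (cst _)).
by apply: continuous_quad_form => //; exact: continuous_invmx.
Qed.

(** The strict condition on the time coordinate may be relaxed: a zero time coordinate would make
    [x] tangent at the origin, with nonnegative square. *)
Lemma hyperboloid_closed : closed (hyperboloid : set 'cV[R]_d.+1).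
Proof.
have cl (x : 'cV[R]_d.+1) : continuous_at x (fun y : 'cV[R]_d.+1 => lorentz y y).
  by apply: (@continuous_lorentz _ _ x d id id); exact: cvg_id.
rewrite (_ : hyperboloid = [set x | 0 <= - lorentz x x - 1] `&`
  ([set x | 0 <= lorentz x x + 1] `&` [set x | 0 <= x ord0 0])); last first.
  apply/seteqP; split=> x.
    by move=> [xx x0]; rewrite /= xx opprK subrr addNr lexx ltW.
  rewrite /= subr_ge0 => -[x1 [x2 x0]].
  have xx : lorentz x x = -1.
    by apply/eqP; rewrite eq_le -[X in _ && X]subr_ge0 opprK x2 andbT lerNr.
  split => //; rewrite lt_def x0 andbT; apply/negP => /eqP x00.
  have : tangent origin x by rewrite /tangent /= lorentz_origin x00 oppr0.
  by move=> /lorentz_ge0_origin; rewrite xx ler0N1.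
have cst (a : R) x := @continuous_at_cst ('cV[R]_d.+1) x R a.
apply: closedI; last apply: closedI; apply: closed_ge0 => x.
- by apply: continuous_atD (cst _ _); apply: continuous_atN.
- exact: continuous_atD (cst _ _).
- exact: coord_continuous.
Qed.

Lemma sample_space_closed : closed (sample_space : set 'M[R]_(d.+1, n)).
Proof.
rewrite (_ : sample_space = \bigcap_i (col i @^-1` hyperboloid)); last first.
  by apply/seteqP; split=> X SX i; [move=> _; exact: SX|exact: SX].
apply: closed_bigI => i _; apply: closed_comp; last exact: hyperboloid_closed.
move=> X _; apply/continuous_mxP => k l.
apply: eq_continuous_at => [t|]; first by rewrite mxE.
exact: coord_continuous.
Qed.

(** The spatial squares sum to the square of the time coordinate minus 1. Hence leaving a box forces
    the time coordinate to be large. *)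
Lemma hyperboloid_entry mu k : hyperboloid mu -> `|mu k 0| <= mu ord0 0.
Proof.
move=> [mm m0]; have [j ->|->] := unliftP ord0 k; last by rewrite gtr0_norm.
rewrite -(@ler_pXn2r _ 2) ?nnegrE ?(ltW m0) // real_normK ?num_real //.
move/eqP : mm; rewrite /lorentz addrC subr_eq => /eqP.
rewrite (bigD1 j) //= -!expr2 => e.
have : 0 <= \sum_(i < d | i != j) mu (lift ord0 i) 0 * mu (lift ord0 i) 0.
  by apply: sumr_ge0 => i _; rewrite -expr2 sqr_ge0.
move: e; move: (\sum_(_ < _ | _) _) (mu _ _ ^+ 2) (mu _ _ ^+ 2) => *; lra.
Qed.

Context {lmin lmax : R} (hlmin : 0 < lmin) (hlmax : lmin < lmax).
Hypotheses (d0 : (0 < d)%N) (n0 : (0 < n)%N).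

Lemma chart_loglik_le : exists c : R, forall X mu Sigma (i : 'I_n),
  sample_space X -> hyperboloid mu -> shell lmin lmax Sigma ->
  chart_loglik X mu Sigma <= c - arcosh (- lorentz mu (col i X)) ^+ 2 / (2 * lmax).
Proof.
have lmax0 : 0 < lmax by exact: lt_trans hlmax.
have [||S0 [_ S0min]] := @compact_argmin R _ (shell lmin lmax : set 'M[R]_d)
    (fun S => ln (\det S)) _ (shell_compact hlmin hlmax).
- by exists lmin%:M; exact: shell_scalar.
- move=> S /set_mem sS; apply: (@continuous_ln_det R _ S _ id); last exact: cvg_id.
  exact: (shell_det sS).
(* [b] is the largest value of the determinant term on the shell; the final constant adds one copy
   per observation. *)
pose b : R := - 2^-1 * ln (\det S0); exists (n%:R * b) => X mu S i SX hmu sS.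
pose rho i := arcosh (- lorentz mu (col i X)).
have rho0 j : 0 <= rho j.
  by apply: arcosh_ge0; exact: lorentz_hyperboloid_le.
have le j : chart_log_density mu S (col j X) <= b - rho j ^+ 2 / (2 * lmax).
  rewrite /chart_log_density -/(rho j) /b.
  have := S0min S sS.
  have := quad_form_invmx_ge hlmin hlmax (chart mu (col j X)) sS.
  have -> : sqnorm (chart mu (col j X)) = rho j ^+ 2.
    by rewrite /rho -euclid_norm_chart // sqr_sqrtr // sqnorm_ge0.
  have -> : rho j ^+ 2 / (2 * lmax) = 2^-1 * (rho j ^+ 2 / lmax).
    by field; rewrite gt_eqF.
  have : 0 <= (d%:R - 1) * ln (sinhc (rho j)) :> R.
    by rewrite mulr_ge0 ?ln_ge0 ?sinhc_ge1 // subr_ge0 ler1n.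
  have ar (l0 l q r p : R) : 0 <= p -> r <= q -> l0 <= l ->
      - 2^-1 * l - 2^-1 * q - p <= - 2^-1 * l0 - 2^-1 * r by move=> *; lra.
  exact: ar.
apply: (@le_trans _ _ (\sum_(j < n) (b - rho j ^+ 2 / (2 * lmax)))).
  by apply: ler_sum => j _; exact: le.
(* Of the distance terms only the one of index [i] is kept. *)
rewrite big_split /= sumr_const card_ord -(mulr_natl b) lerD2l sumrN lerN2.
rewrite (bigD1 i) //= lerDl; apply: sumr_ge0 => j _.
by rewrite divr_ge0 ?sqr_ge0 // mulr_ge0 // ltW.
Qed.

Lemma chart_loglik_coercive (N : nat) : exists M : R,
  forall X mu Sigma, sample_space X -> mx_box N.+1%:R X -> hyperboloid mu ->
  shell lmin lmax Sigma -> ~ mx_box M mu ->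
  chart_loglik X mu Sigma < chart_loglik X origin lmin%:M.
Proof.
have lmax0 : 0 < lmax by exact: lt_trans hlmax.
have [c cP] := chart_loglik_le.
pose D : set 'M[R]_(d.+1, n) := mx_box N.+1%:R `&` sample_space.
(* A lower bound of the reference value, uniform over the compact set of samples [D]. *)
have [b bP] : exists b, forall X, D X -> b <= chart_loglik X origin lmin%:M.
  have [D0|nD] := pselect (D !=set0); last by exists 0 => X DX; case: nD; exists X.
  have cD : compact D.
    exact: compact_closedI (@mx_box_compact _ _ _ _) sample_space_closed.
  have [|X0 [_ X0min]] := @compact_argmin R _ D
      (fun X => chart_loglik X origin lmin%:M) D0 cD.
    move=> X /set_mem [_ SX]; apply: (@continuous_chart_loglik _ X id) => //.
    - exact: origin_hyperboloid.
    - exact: (shell_det (shell_scalar hlmin hlmax)).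
    - exact: continuous_at_cst.
    - exact: continuous_at_cst.
  by exists (chart_loglik X0 origin lmin%:M).
(* The upper bound drops below [b] once the squared distance exceeds [E]. As [- <mu, x>] is at least
   half of [mu_0 / x_0] and [x_0 <= N1], a time coordinate [mu_0] above the radius chosen next gives
   distance at least [1 + |E|], whose square exceeds [E]. *)
pose E := 2 * lmax * (c - b); pose N1 : R := N.+1%:R.
exists (2 * N1 * expR (1 + `|E|)) => X mu S SX XN hmu sS nM.
have N10 : 0 < N1 by rewrite ltr0n.
pose i := Ordinal n0; apply: le_lt_trans (cP X mu S i SX hmu sS) _.
apply: lt_le_trans (bP X (conj XN SX)).
have mu0 : 2 * N1 * expR (1 + `|E|) < mu ord0 0.
  rewrite ltNge; apply/negP => le; apply: nM => k j; rewrite ord1.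
  by apply: le_trans le; exact: hyperboloid_entry.
have [xx x0] := SX i; have [_ m0] := hmu.
have xN : col i X ord0 0 <= N1.
  by rewrite mxE; apply: le_trans (XN ord0 i); exact: ler_norm.
have l_ge : expR (1 + `|E|) <= - lorentz mu (col i X).
  apply: le_trans (lorentz_hyperboloid_ge hmu (SX i)).
  rewrite -mulrA -invfM ler_pdivlMr ?mulr_gt0 //.
  apply: le_trans (ltW mu0); rewrite mulrC ler_pM2r ?expR_gt0 //.
  by rewrite mulrC ler_pM2l.
have r_ge : 1 + `|E| <= arcosh (- lorentz mu (col i X)).
  apply: le_trans (arcosh_ge_ln _); last by exact: lorentz_hyperboloid_le.
  rewrite -[leLHS]expRK ler_ln ?posrE ?expR_gt0 //.
  by rewrite oppr_gt0; exact: lorentz_hyperboloid_lt0.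
have E0 := normr_ge0 E; have EE := ler_norm E.
have : E < arcosh (- lorentz mu (col i X)) ^+ 2.
  apply: (@lt_le_trans _ _ ((1 + `|E|) ^+ 2)).
    by apply: le_lt_trans EE _; rewrite expr2; nra.
  by rewrite ler_pXn2r ?nnegrE ?(le_trans _ r_ge) // addr_ge0.
rewrite ltrBlDr addrC -ltrBlDr ltr_pdivlMr ?mulr_gt0 //.
by rewrite mulrC.
Qed.

End likelihood.

(** * Existence of the joint and profile maximizers *)

Section maximum_likelihood.
Context {R : realType} {d n : nat} {lmin lmax : R}.
Hypotheses (d0 : (0 < d)%N) (n0 : (0 < n)%N).
Hypotheses (hlmin : 0 < lmin) (hlmax : lmin < lmax).

Let K : set 'M[R]_d := shell lmin lmax.
Let f := @chart_loglik R d n.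

Let cf (I : topologicalType) (i : I) (X : I -> 'M[R]_(d.+1, n))
    (mu : I -> 'cV[R]_d.+1) (S : I -> 'M[R]_d) :
  sample_space (X i) -> hyperboloid (mu i) -> K (S i) ->
  {for i, continuous X} -> {for i, continuous mu} -> {for i, continuous S} ->
  {for i, continuous (fun j => f (X j) (mu j) (S j))}.
Proof.
by move=> SX hmu KS; apply: continuous_chart_loglik => //; exact: shell_det KS.
Qed.

(** Coordinates indexed by natural numbers through [inord], the form used by the lexicographic
    selection; the first [d.+1] of them separate points. *)
Let coord (i : nat) (u : 'cV[R]_d.+1) : R := u (inord i) 0.

Let coord_cont i : continuous (coord i).
Proof. exact: coord_continuous. Qed.

Let coord_inj u v : (forall i, (i < d.+1)%N -> coord i u = coord i v) -> u = v.
Proof.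
move=> uv; apply/matrixP => i j; rewrite ord1.
by have := uv i (ltn_ord i); rewrite /coord inord_val.
Qed.

Let sample_exhaust : sample_space `<=` \bigcup_N @mx_box R d.+1 n N.+1%:R.
Proof. by move=> X _; have [N XN] := mx_box_exhaust X; exists N. Qed.

Let Kc : compact K := shell_compact hlmin hlmax.
Let Kcl : closed K := shell_closed hlmin.
Let K0 : K lmin%:M := shell_scalar hlmin hlmax.
Let clB N := @mx_box_closed R d.+1 n N.+1%:R.
Let cB N := @mx_box_compact R d.+1 n N.+1%:R.

Lemma joint_MLE_exists (X : 'M[R]_(d.+1, n)) : sample_space X ->
  argmax_on (hyperboloid `*` K) (fun theta => loglik X theta.1 theta.2) !=set0.
Proof.
move=> SX; have [M MP] := choice (chart_loglik_coercive hlmin hlmax d0 n0).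
have [z [[hz Kz] zmax]] := @joint_argmax_nonempty R _ _ _ f sample_space hyperboloid
  K hyperboloid_closed Kc cf origin lmin%:M origin_hyperboloid K0
  (fun N => mx_box N.+1%:R) (fun N => mx_box (M N)) sample_exhaust
  (fun N => @mx_box_compact R d.+1 1 (M N))
  MP X SX.
exists z; split => // y [hy Ky]; rewrite !loglikE //; exact: (zmax y).
Qed.

Lemma profile_cov_exists : exists Stilde : 'M[R]_(d.+1, n) -> 'cV[R]_d.+1 -> 'M[R]_d,
  is_profile_cov K Stilde.
Proof.
exists (fun X mu => get (argmin_on K (cov_objective X mu))) => X mu SX hmu.
apply: getPex.
have [||S [KS Smax]] := @compact_argmax R _ K (f X mu) _ Kc.
- by exists lmin%:M.
- move=> S /set_mem KS; apply: (@cf _ S (fun=> X) (fun=> mu) id) => //.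
  + exact: continuous_at_cst.
  + exact: continuous_at_cst.
exists S; split => // S' KS'.
by rewrite cov_objective_le // !loglikE //; exact: Smax.
Qed.

(** The selection is made among the joint maximizers, which do not refer to [Stilde]; measurability
    of the estimator therefore holds for any choice of profile covariance. *)
Lemma profile_MLE_exists (Stilde : 'M[R]_(d.+1, n) -> 'cV[R]_d.+1 -> 'M[R]_d) :
  is_profile_cov K Stilde -> exists muhat Sigmahat, is_profile_MLE Stilde muhat Sigmahat.
Proof.
move=> SP; have [M MP] := choice (chart_loglik_coercive hlmin hlmax d0 n0).
have [muhat [muhat_meas muhat_max]] := @measurable_partial_argmax R
  'M[R]_(d.+1, n) 'cV[R]_d.+1 _ f sample_space hyperboloid K
  (@norm_hausdorff _ _) sample_space_closed hyperboloid_closed Kcl Kc cf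
  origin lmin%:M origin_hyperboloid K0
  (fun N => mx_box N.+1%:R) (fun N => mx_box (M N)) clB cB sample_exhaust
  (fun N => @mx_box_closed R d.+1 1 (M N)) (fun N => @mx_box_compact R d.+1 1 (M N))
  MP
  coord d.+1 coord_cont coord_inj.
exists muhat, (fun X => Stilde X (muhat X)); split => // X SX.
have [[mu S] [[/= hmu KS] musmax] /= e] := muhat_max X SX.
rewrite -e; split => // nu hnu.
have [KSt Stmin] := SP X mu SX hmu; have [KSn _] := SP X nu SX hnu.
(* Joint maximality of [(mu, S)] bounds the profile value at [nu], and optimality of [Stilde X mu]
   at fixed [mu] bounds the likelihood of [(mu, S)]. *)
apply: (@le_trans _ _ (loglik X mu S)).
  by rewrite !loglikE //; exact: (musmax (nu, Stilde X nu)).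
by rewrite -cov_objective_le // Stmin.
Qed.

End maximum_likelihood.

Unset Implicit Arguments.

Theorem theorem4p1 (R : realType) (d n : nat) (lmin lmax : R)
    (hd : (2 <= d)%N) (hn : (1 <= n)%N) (hlmin : 0 < lmin)
    (hlmax : lmin < lmax) :
  (forall X : 'M[R]_(d.+1, n), sample_space X ->
     argmax_on (hyperboloid `*` shell lmin lmax)
       (fun theta : 'cV[R]_d.+1 * 'M[R]_d => loglik X theta.1 theta.2)
     !=set0) /\
  (exists Sigmatilde : 'M[R]_(d.+1, n) -> 'cV[R]_d.+1 -> 'M[R]_d,
     is_profile_cov (shell lmin lmax) Sigmatilde) /\
  (forall Sigmatilde : 'M[R]_(d.+1, n) -> 'cV[R]_d.+1 -> 'M[R]_d,
     is_profile_cov (shell lmin lmax) Sigmatilde ->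
     exists (muhat : 'M[R]_(d.+1, n) -> 'cV[R]_d.+1)
            (Sigmahat : 'M[R]_(d.+1, n) -> 'M[R]_d),
       is_profile_MLE Sigmatilde muhat Sigmahat).
Proof.
have d0 : (0 < d)%N by exact: leq_trans hd.
split; first by move=> X; exact: joint_MLE_exists.
split; first exact: profile_cov_exists.
by move=> Sigmatilde; exact: profile_MLE_exists.
Qed.
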